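(* Let $\Pi$ be a finite set of proposition symbols and $I=[a]$ with $a$ a positive integer. Every class of finite pointed $(\Pi,I)$-models definable by a countable disjunction of $(\Pi,I)$-formulae of graded multimodal logic is recognizable by a counting multichannel type automaton for $(\Pi,I)$. Moreover, if the disjunction is recursively enumerable, then the automaton can be taken to be recursively enumerable.
   Context: $(\Pi,I)$-formulae of graded multimodal logic (GMML) are generated by $\varphi ::= \top \mid p \mid \neg\varphi \mid (\varphi\land\varphi) \mid \langle\alpha\rangle_{\geq k}\varphi$ with $p\in\Pi$, $\alpha\in I$, $k\in\mathbb N$; $\langle\alpha\rangle_{=k}\varphi$ abbreviates $\langle\alpha\rangle_{\geq k}\varphi\land\neg\langle\alpha\rangle_{\geq k+1}\varphi$. A $(\Pi,I)$-model is $M=(W,(R_\alpha)_{\alpha\in I},V)$ with $W$ nonempty finite, $R_\alpha\subseteq W\times W$, $V\colon\Pi\to\wp(W)$; a pointed model is $(M,w)$; $\mathcal N^\alpha(w)=\{v:(w,v)\in R_\alpha\}$. Semantics is standard, with $(M,w)\models\langle\alpha\rangle_{\geq k}\psi$ iff $|\{v\in\mathcal N^\alpha(w):(M,v)\models\psi\}|\geq k$. A class $\mathcal K$ of finite pointed $(\Pi,I)$-models is definable by a countable disjunction if there is a countable set $S$ of formulae with $(M,w)\in\mathcal K$ iff $(M,w)\models\varphi$ for some $\varphi\in S$, for every finite pointed $(\Pi,I)$-model; the disjunction is recursively enumerable if $S$ is. Full graded multimodal types: $\tau^{(M,w)}_\varepsilon$ is the canonically ordered conjunction of $p$ ($p\in\Pi$,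 $w\in V(p)$) and $\neg p$ ($p\in\Pi$, $w\notin V(p)$), $\top$ if $\Pi=\emptyset$. For widths $\mathbf k=(\mathbf k_1,\dots,\mathbf k_n)$, $\mathbf k_i\in\mathbb N^{|I|}$, $T_{\mathbf k}$ is the set of all types of width $\mathbf k$ of finite pointed models, and for $\mathbf k_0=(k_1,\dots,k_{|I|})$, $\tau^{(M,w)}_{(\mathbf k_0,\mathbf k)}$ is the canonical conjunction of $\tau^{(M,w)}_\varepsilon$, all $\langle\alpha\rangle_{=\ell}\tau$ ($1\le\ell\le k_\alpha-1$, $\tau\in T_{\mathbf k}$) true at $(M,w)$, all $\langle\alpha\rangle_{\geq k_\alpha}\tau$ ($\tau\in T_{\mathbf k}$) true at $(M,w)$, and all $\langle\alpha\rangle_{=|\mathcal N^\alpha(w)|}\top$ with $k_\alpha>|\mathcal N^\alpha(w)|$. The full type of depth $0$ is $\tau^{(M,w)}_0=\tau^{(M,w)}_\varepsilon$; the full type of depth $n+1$ is $\tau^{(M,w)}_{n+1}=\tau^{(M,w)}_{(\mathbf k_1,\dots,\mathbf k_{n+1})}$ for any widths with $k_{i,\alpha}>\max\{|\mathcal N^\alpha(v)|:(w,v)\in(\bigcup_\beta R_\beta)^{i-1}\}$. $\mathcal T$ is the set of all full types (all depths). A multiset over $X$ is a function $X\to\mathbb N$; $\mathfrak m(X)$ is the set of multisets over $X$. A counting multichannel message passing automaton (CMMPA) for $(\Pi,I)$ is $A=(Q,\pi,\delta,F)$ with $Q$ a nonempty countable set, $\pi\colon\wp(\Pi)\to Q$,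 $\delta\colon\mathfrak m(Q)^{|I|}\times Q\to Q$, $F\subseteq Q$. On a finite model $M$, $f_0(w)=\pi(\{p\in\Pi:w\in V(p)\})$ and $f_{t+1}(w)=\delta(N_1,\dots,N_{|I|},f_t(w))$, where $N_\alpha$ is the multiset of values $f_t(v)$, $v\in\mathcal N^\alpha(w)$. $A$ accepts $(M,w)$ if $f_t(w)\in F$ for some $t\in\mathbb N$; $A$ recognizes $\mathcal K$ if it accepts exactly the finite pointed models in $\mathcal K$. $A$ is recursively enumerable if $F$ is recursively enumerable and $\delta$ is computable. A counting multichannel type automaton for $(\Pi,I)$ is a CMMPA with state set $\mathcal T$, $\pi(\Pi')$ the depth-$0$ type (conjunction of $p\in\Pi'$ and $\neg p$ for $p\in\Pi\setminus\Pi'$), arbitrary $F\subseteq\mathcal T$, and, when all types in $N_1,\dots,N_{|I|}$ and $\tau$ have the same depth, $\delta(N_1,\dots,N_{|I|},\tau)=\tau_0\land\bigwedge\{\langle\alpha\rangle_{=k}\sigma:\alpha\in I,\ 1\le k\le|N_\alpha|,\ \sigma\text{ occurs exactly }k\text{ times in }N_\alpha\}\land\bigwedge\{\langle\alpha\rangle_{=|N_\alpha|}\top:\alpha\in I\}$, where $\tau_0$ is the depth-$0$ type occurring in $\tau$ outside the scope of any diamond (other inputs are mapped arbitrarily). Its state at $(M,w)$ in round $n$ is $\tau^{(M,w)}_n$. *)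

(* Defs.v *)
From HB Require Import structures.
From mathcomp Require Import all_boot.
From Stdlib Require Import ClassicalEpsilon ProofIrrelevance.

Set Implicit Arguments.
Unset Strict Implicit.
Unset Printing Implicit Defensive.

Section Formula.
Variables (P : finType) (a : nat).

Inductive formula : Type :=
| FTop : formula
| FVar : P -> formula
| FNeg : formula -> formula
| FAnd : formula -> formula -> formula
| FDia : 'I_a -> nat -> formula -> formula.

Local Notation leafT := (P + ('I_a * nat))%type.

Fixpoint formula_enc (f : formula) : GenTree.tree leafT :=
  match f with
  | FTop => GenTree.Node 0 [::]
  | FVar p => GenTree.Leaf (inl p)
  | FNeg g => GenTree.Node 1 [:: formula_enc g]
  | FAnd g h => GenTree.Node 2 [:: formula_enc g; formula_enc h]
  | FDia al k g => GenTree.Node 3 [:: GenTree.Leaf (inr (al, k)); formula_enc g]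
  end.

Fixpoint formula_dec (t : GenTree.tree leafT) : option formula :=
  match t with
  | GenTree.Leaf (inl p) => Some (FVar p)
  | GenTree.Node 0 [::] => Some FTop
  | GenTree.Node 1 [:: t1] => omap FNeg (formula_dec t1)
  | GenTree.Node 2 [:: t1; t2] =>
      match formula_dec t1, formula_dec t2 with
      | Some g, Some h => Some (FAnd g h)
      | _, _ => None
      end
  | GenTree.Node 3 [:: GenTree.Leaf (inr (al, k)); t1] =>
      omap (FDia al k) (formula_dec t1)
  | _ => None
  end.

Lemma formula_encK : pcancel formula_enc formula_dec.
Proof. by elim=> //= [g -> | g -> h -> | al k g ->]. Qed.

End Formula.

HB.instance Definition _ (P : finType) (a : nat) :=
  Countable.copy (formula P a) (pcan_type (@formula_encK P a)).

Arguments FTop {P a}.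
Arguments FVar {P a}.
Arguments FNeg {P a}.
Arguments FAnd {P a}.
Arguments FDia {P a}.

Section Semantics.
Variables (P : finType) (a : nat).
Local Notation formula := (formula P a).

Definition FDiaEq (al : 'I_a) (k : nat) (f : formula) : formula :=
  FAnd (FDia al k f) (FNeg (FDia al k.+1 f)).

(* A (P,'I_a)-model on a finite carrier W (W is nonempty as soon as a  *)
(* point is given).                                                     *)
Record model (W : finType) := Model {
  mrel : 'I_a -> rel W;
  mval : P -> {set W}
}.

Definition nbhd W (M : model W) (al : 'I_a) (w : W) : {set W} :=
  [set v | mrel M al w v].

Fixpoint sat W (M : model W) (w : W) (f : formula) {struct f} : bool :=
  match f with
  | FTop => true
  | FVar p => w \in mval M p
  | FNeg g => ~~ sat M w g
  | FAnd g h => sat M w g && sat M w h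
  | FDia al k g => k <= #|[set v | mrel M al w v & sat M v g]|
  end.

Definition mclass := forall W : finType, model W -> W -> Prop.

(* K is definable by the (countable, since formulae are countable)      *)
(* disjunction of the set S of formulae.                                *)
Definition defines (S : formula -> Prop) (K : mclass) : Prop :=
  forall (W : finType) (M : model W) (w : W),
    K W M w <-> exists f, S f /\ sat M w f.

Inductive cm_instr := CM_INC of nat & nat | CM_DEC of nat & nat & nat.

Definition cm_step (p : seq cm_instr) (s : nat * (nat -> nat)) :=
  let: (pc, rg) := s in
  match nth None (map Some p) pc with
  | Some (CM_INC r j) => (j, fun x => if x == r then (rg x).+1 else rg x)
  | Some (CM_DEC r j k) =>
      if rg r is m.+1 then (j, fun x => if x == r then m else rg x)
      else (k, rg)
  | None => s
  end.

(* input in register 1, output read in register 0 *)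
Definition cm_run (p : seq cm_instr) (n t : nat) : nat * (nat -> nat) :=
  iter t (cm_step p) (0, fun x => if x == 1 then n else 0).

Definition cm_halts p n t := size p <= (cm_run p n t).1.

Definition re_nat (A : nat -> Prop) : Prop :=
  exists p, forall n, A n <-> exists t, cm_halts p n t.

Definition re_set (T : countType) (A : T -> Prop) : Prop :=
  re_nat (fun n => exists x, A x /\ pickle x = n).

Definition mset (Q : Type) := Q -> nat.

Definition props_at W (M : model W) (w : W) : {set P} :=
  [set p | w \in mval M p].

Fixpoint run (Q : countType) (pi : {set P} -> Q)
    (delta : ('I_a -> mset Q) -> Q -> Q) W (M : model W) (t : nat) : W -> Q :=
  match t with
  | 0 => fun w => pi (props_at M w)
  | t'.+1 => fun w =>
      delta (fun al q => #|[set v | mrel M al w v & run pi delta M t' v == q]|)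
            (run pi delta M t' w)
  end.

Definition accepts (Q : countType) pi delta (F : Q -> Prop) W (M : model W) w :=
  exists t, F (@run Q pi delta W M t w).

Definition recognizes (Q : countType) pi delta (F : Q -> Prop) (K : mclass) :=
  forall (W : finType) (M : model W) (w : W), K W M w <-> accepts pi delta F M w.

Definition mset_of (Q : eqType) (s : seq Q) : mset Q := fun q => count_mem q s.

(* delta is computable: some counter machine maps the code of           *)
(* (N_1,...,N_a, q), each finite multiset N_i given by any list listing  *)
(* its elements with multiplicity, to the code of delta(N_1,...,N_a,q).  *)
Definition delta_computable (Q : countType) (delta : ('I_a -> mset Q) -> Q -> Q) :=
  exists p, forall (ls : 'I_a -> seq Q) (q : Q),
    let n := pickle ([seq [seq pickle x | x <- ls al] | al <- enum 'I_a], pickle q) in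
    exists t, cm_halts p n t /\
      (cm_run p n t).2 0 = pickle (delta (fun al => mset_of (ls al)) q).

Definition re_automaton (Q : countType) (delta : ('I_a -> mset Q) -> Q -> Q)
    (F : Q -> Prop) := re_set F /\ delta_computable delta.

Fixpoint conjL (s : seq formula) : formula :=
  match s with
  | [::] => FTop
  | [:: f] => f
  | f :: s' => FAnd f (conjL s')
  end.

Definition le_formula (f g : formula) : bool := pickle f <= pickle g.

Definition canon (s : seq formula) : seq formula := sort le_formula (undup s).

Definition type_eps_set (S : {set P}) : formula :=
  conjL [seq if p \in S then FVar p else FNeg (FVar p) | p <- enum P].

Definition type_eps W (M : model W) (w : W) : formula :=
  type_eps_set (props_at M w).

(* The conjunct <al>_{=l} tau (resp. <al>_{>=k} tau) with tau in T_ks'   *)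
(* is true at w iff exactly l (resp. at least k) al-successors v of w    *)
(* have type tau, i.e. tau is the width-ks' type of v.                   *)
Fixpoint type_w W (M : model W) (ks : seq ('I_a -> nat)) (w : W) : formula :=
  match ks with
  | [::] => type_eps M w
  | k0 :: ks' =>
      let succ al := [seq type_w M ks' v | v <- enum (nbhd M al w)] in
      let rest :=
        [seq (let c := count_mem tau (succ al) in
              if c < k0 al then FDiaEq al c tau else FDia al (k0 al) tau)
          | al <- enum 'I_a, tau <- undup (succ al)]
        ++ [seq FDiaEq al #|nbhd M al w| FTop
             | al <- enum 'I_a & #|nbhd M al w| < k0 al] in
      conjL (type_eps M w :: canon rest)
  end.

Fixpoint reach W (M : model W) (i : nat) (w : W) : {set W} :=
  match i with
  | 0 => [set w]
  | i'.+1 => [set v | [exists u in reach M i' w, [exists al, mrel M al u v]]]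
  end.

Definition full_widths W (M : model W) (n : nat) (w : W) : seq ('I_a -> nat) :=
  mkseq (fun i al => (\max_(v in reach M i w) #|nbhd M al v|).+1) n.

Definition full_type W (M : model W) (n : nat) (w : W) : formula :=
  type_w M (full_widths M n w) w.

Definition is_full_type (n : nat) (tau : formula) : Prop :=
  exists (W : finType) (M : model W) (w : W), full_type M n w = tau.

Definition is_full (tau : formula) : Prop := exists n, is_full_type n tau.

Definition fullT := {tau : formula | is_full tau}.

Definition fullT_dec (f : formula) : option fullT :=
  match excluded_middle_informative (is_full f) with
  | left h => Some (exist _ f h)
  | right _ => None
  end.

Lemma fullT_valK : pcancel (@proj1_sig _ _ : fullT -> formula) fullT_dec.
Proof.
move=> [f h]; rewrite /fullT_dec /=.
case: excluded_middle_informative => [h'|//].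
by rewrite (proof_irrelevance _ h h').
Qed.

End Semantics.

HB.instance Definition _ (P : finType) (a : nat) :=
  Countable.copy (fullT P a) (pcan_type (@fullT_valK P a)).

Section TypeAutomaton.
Variables (P : finType) (a : nat).
Local Notation formula := (formula P a).
Local Notation fullT := (fullT P a).

Fixpoint modal_free (f : formula) : bool :=
  match f with
  | FTop | FVar _ => true
  | FNeg g => modal_free g
  | FAnd g h => modal_free g && modal_free h
  | FDia _ _ _ => false
  end.

(* the depth-0 type occurring in tau outside the scope of any diamond *)
Definition type0_of (tau : formula) : formula :=
  if modal_free tau then tau
  else if tau is FAnd t0 _ then t0 else tau.

Definition type_delta_value (ls : 'I_a -> seq fullT) (tau : fullT) : formula :=
  conjL (type0_of (proj1_sig tau) ::
    canon ([seq FDiaEq al (count_mem s (ls al)) (proj1_sig s)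
             | al <- enum 'I_a, s <- undup (ls al)]
           ++ [seq FDiaEq al (size (ls al)) FTop | al <- enum 'I_a])).

Definition type_automaton (pi : {set P} -> fullT)
    (delta : ('I_a -> mset fullT) -> fullT -> fullT) : Prop :=
  (forall S : {set P}, proj1_sig (pi S) = type_eps_set a S) /\
  (forall (N : 'I_a -> mset fullT) (tau : fullT) (n : nat),
     (forall al s, 0 < N al s -> is_full_type n (proj1_sig s)) ->
     is_full_type n (proj1_sig tau) ->
     forall ls : 'I_a -> seq fullT, (forall al, N al =1 mset_of (ls al)) ->
     proj1_sig (delta N tau) = type_delta_value ls tau).

End TypeAutomaton.

(* Main.v *)
Require Import Defs.
From HB Require Import structures.
From mathcomp Require Import all_boot zify.
From Stdlib Require Import ClassicalEpsilon FunctionalExtensionality.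

Set Implicit Arguments.
Unset Strict Implicit.
Unset Printing Implicit Defensive.

(* The full type of depth n of a pointed model is a Hintikka formula: any model  *)
(* of it has the same full type of depth n, hence satisfies the same formulae of *)
(* modal depth at most n.  The state of a type automaton in round n is the type  *)
(* of depth n, so it suffices to accept every full type of some depth n realized *)
(* by a model of some formula of S of depth at most n.                           *)
(*                                                                               *)
(* For computability, pickling makes every countable type a type of binary trees *)
(* coded by numbers, with pairing 2^a(2b+1).  While programs over a stack of     *)
(* registers compile to counter machines and compute the pairing functions,      *)
(* iteration and hence list and formula recursion.  The transition function is   *)
(* only prescribed when the input types have a common depth; this is decidable   *)
(* because a full type determines its depth except when it describes a tree      *)
(* without long paths, in which case it is a type of every larger depth too.     *)
(* Acceptance is semi-decided by a search over finite models coded by numbers.   *)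

(** * While programs and counter machines *)

(** A full type of depth [n+1] records the atoms of a point, the exact number of successors of each
    type of depth [n], and the total number of successors. By induction it holds at a point exactly
    when it is the type of that point ([ftype_sat]), and points with the same type of depth [n]
    agree on all formulae of depth at most [n] ([sat_ftype_eq]). Round [t] of every type automaton
    computes the type of depth [t] ([run_ftype]). Hence a point satisfying a formula [f] of [S]
    reaches an accepting state at round [depth f]; conversely an accepting state is a formula that
    holds at the point and forces some formula of [S] ([accepting_recognizes]).

    A transition function with values in the full types exists because models of any finite family
    of types of one depth can be hung below a fresh root ([is_full_node_type]).

    Effectiveness rests on two facts. Whether given full types share a depth is decidable
    ([consistentP]), so the transition function is computable ([type_delta_computable]). The
    accepting types are those for which some number codes a formula, a halting time of the machine
    for [S] on it, and a finite model of it with the given type ([accepting_re]). Both descend to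
    counter machines through [comput], by [cfun_machine] for total functions and [cfun_search] for
    unbounded search. *)

Inductive cmd :=
| Inc of nat
| Dec of nat
| Seq of cmd & cmd
| While of nat & cmd.

Definition upd (s : nat -> nat) r v : nat -> nat :=
  fun x => if x == r then v else s x.

(* [While r c] decrements [r] before each execution of [c]. *)
Inductive exec : cmd -> (nat -> nat) -> (nat -> nat) -> Prop :=
| XInc r s : exec (Inc r) s (fun x => if x == r then (s x).+1 else s x)
| XDec r s : exec (Dec r) s (upd s r (s r).-1)
| XSeq c1 c2 s1 s2 s3 :
    exec c1 s1 s2 -> exec c2 s2 s3 -> exec (Seq c1 c2) s1 s3
| XWhile0 r c s : s r = 0 -> exec (While r c) s s
| XWhileS r c s1 s2 s3 m :
    s1 r = m.+1 -> exec c (upd s1 r m) s2 -> exec (While r c) s2 s3 ->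
    exec (While r c) s1 s3.

Fixpoint cmd_size c :=
  match c with
  | Inc _ | Dec _ => 1
  | Seq c1 c2 => cmd_size c1 + cmd_size c2
  | While _ c => (cmd_size c).+1
  end.

(** Jumps are absolute: [start] is the address at which the block is placed and [exit] the address
    reached on completion. *)
Fixpoint compile c start exit : seq cm_instr :=
  match c with
  | Inc r => [:: CM_INC r exit]
  | Dec r => [:: CM_DEC r exit exit]
  | Seq c1 c2 =>
      compile c1 start (start + cmd_size c1) ++
      compile c2 (start + cmd_size c1) exit
  | While r c => CM_DEC r start.+1 exit :: compile c start.+1 start
  end.

Lemma size_compile c start exit : size (compile c start exit) = cmd_size c.
Proof.
elim: c start exit => //= [c1 IH1 c2 IH2 | r c IH] st ex; last by rewrite IH.
by rewrite size_cat IH1 IH2.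
Qed.

Lemma nth_instr pre i post :
  nth None (map Some (pre ++ i :: post)) (size pre) = Some i :> option cm_instr.
Proof. by rewrite map_cat nth_cat size_map ltnn subnn. Qed.

Lemma upd_id s r : upd s r (s r) = s.
Proof.
by apply: functional_extensionality => x; rewrite /upd; case: eqP => // ->.
Qed.

(** The surrounding code [pre] and [post] is arbitrary, so that the induction hypotheses apply to
    the parts of a compound command in place. *)
Lemma compile_sound c s s' : exec c s s' -> forall pre post ex,
  let p := pre ++ compile c (size pre) ex ++ post in
  exists2 t, 0 < t & iter t (cm_step p) (size pre, s) = (ex, s').
Proof.
elim=> {c s s'} [r s|r s|c1 c2 s1 s2 s3 _ IH1 _ IH2|r c s sr|r c s1 s2 s3 m sr _ IHc _ IHw]
  pre post ex p.
- by exists 1; rewrite //= nth_instr.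
- exists 1; rewrite //= nth_instr; case sr: (s r) => [|m] //=.
  by rewrite -[X in upd s r X]sr upd_id.
- have [t1 t1_gt0 E1] := IH1 pre
    (compile c2 (size pre + cmd_size c1) ex ++ post) (size pre + cmd_size c1).
  have [t2 t2_gt0] := IH2 (pre ++ compile c1 (size pre) (size pre + cmd_size c1)) post ex.
  rewrite size_cat size_compile -catA => E2.
  exists (t2 + t1); first by rewrite addn_gt0 t1_gt0 orbT.
  by rewrite iterD /p /= -catA E1.
- by exists 1; rewrite //= nth_instr sr.
- have [tc _] := IHc (rcons pre (CM_DEC r (size pre).+1 ex)) post (size pre).
  rewrite size_rcons cat_rcons => Ec.
  have [tw tw_gt0 Ew] := IHw pre post ex.
  exists (tw + (tc + 1)); first by rewrite addn_gt0 tw_gt0.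
  rewrite /= in Ew.
  by rewrite !iterD /p /= nth_instr sr Ec.
Qed.

(* The registers are used as a stack: [st l xs] holds [l] below the frame [xs] *)
(* and zeros above it.                                                          *)
Definition st (l xs : seq nat) : nat -> nat := fun r => nth 0 (l ++ xs) r.

(** A Hoare triple with a frame: the [k] registers below are preserved, and all registers beyond the
    listed ones are zero before and after. Lists that differ by trailing zeros describe the same
    state. *)
Record runs c k xs ys : Prop := Runs {
  runE : forall l, size l = k -> exec c (st l xs) (st l ys)
}.

Lemma st_eq l xs ys : nth 0 xs =1 nth 0 ys -> st l xs = st l ys.
Proof.
move=> E; apply: functional_extensionality => r; rewrite /st !nth_cat.
by case: ifP.
Qed.

Lemma run_eq c k xs ys xs' ys' :
  runs c k xs ys -> nth 0 xs =1 nth 0 xs' -> nth 0 ys =1 nth 0 ys' ->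
  runs c k xs' ys'.
Proof. by case=> R Ex Ey; split=> l sl; rewrite -(st_eq l Ex) -(st_eq l Ey); apply: R. Qed.

Lemma upd_st l xs i v :
  upd (st l xs) (size l + i) v = st l (set_nth 0 xs i v).
Proof.
apply: functional_extensionality => r; rewrite /upd /st !nth_cat nth_set_nth /=.
case: ltnP => rl; first by rewrite ltn_eqF // ltn_addr.
have -> : (r == size l + i) = (r - size l == i) by lia.
by case: eqP.
Qed.

Lemma st_at l xs i : st l xs (size l + i) = nth 0 xs i.
Proof. by rewrite /st nth_cat ltnNge leq_addr /= addKn. Qed.

Lemma run_inc k i xs :
  runs (Inc (k + i)) k xs (set_nth 0 xs i (nth 0 xs i).+1).
Proof.
split=> l sl; rewrite -upd_st -[nth 0 xs i](st_at l) sl.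
have -> : upd (st l xs) (k + i) (st l xs (k + i)).+1 =
  fun x => if x == k + i then (st l xs x).+1 else st l xs x.
  by apply: functional_extensionality => r; rewrite /upd; case: eqP => // ->.
by constructor.
Qed.

Lemma run_dec k i xs :
  runs (Dec (k + i)) k xs (set_nth 0 xs i (nth 0 xs i).-1).
Proof. by split=> l sl; rewrite -upd_st -[nth 0 xs i](st_at l) sl; constructor. Qed.

Lemma run_seq c1 c2 k xs ys zs :
  runs c1 k xs ys -> runs c2 k ys zs -> runs (Seq c1 c2) k xs zs.
Proof. by case=> R1 [R2]; split=> l sl; apply: XSeq (R1 l sl) (R2 l sl). Qed.

Lemma run_while0 c k i xs : nth 0 xs i = 0 -> runs (While (k + i) c) k xs xs.
Proof. by move=> E; split=> l sl; apply: XWhile0; rewrite -sl st_at. Qed.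

Lemma run_whileS c k i xs m ys zs : nth 0 xs i = m.+1 ->
  runs c k (set_nth 0 xs i m) ys -> runs (While (k + i) c) k ys zs ->
  runs (While (k + i) c) k xs zs.
Proof.
move=> E [Rc] [Rw]; split=> l sl; apply: (XWhileS (m := m) (s2 := st l ys)).
- by rewrite -sl st_at.
- by rewrite -sl upd_st; apply: Rc.
- exact: Rw.
Qed.

Lemma run_shift c k xs ys zs :
  runs c (k + size xs) ys zs -> runs c k (xs ++ ys) (xs ++ zs).
Proof.
case=> R; split=> l sl; rewrite /st !catA; apply: R.
by rewrite size_cat sl.
Qed.

(** [F m] is the loop invariant: the whole frame at the moment when the counter in position [i]
    holds [m]. *)
Lemma run_while_iter c k i n (F : nat -> seq nat) :
  (forall m, m <= n -> nth 0 (F m) i = m) ->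
  (forall m, m < n -> runs c k (set_nth 0 (F m.+1) i m) (F m)) ->
  runs (While (k + i) c) k (F n) (F 0).
Proof.
elim: n => [|n IH] Hi Hr; first by apply: run_while0; apply: Hi.
apply: (run_whileS (m := n) (ys := F n)); first exact: Hi.
  exact: Hr.
by apply: IH => m lemn; [apply: Hi; apply: leqW | apply: Hr; apply: leqW].
Qed.

Ltac nth_cases :=
  repeat rewrite ?nth_set_nth ?nth_rcons /=;
  repeat match goal with
  | |- context [if ?a == ?b then _ else _] =>
      let h := fresh in have [h|h] := eqVneq a b; rewrite ?h ?eqxx
  | |- context [if ?b then _ else _] => let h := fresh in case h: b
  end; try lia;
  try (rewrite nth_default; lia).

Definition move_reg i j := While i (Inc j).

Lemma run_move k i j xs : i != j ->
  runs (move_reg (k + i) (k + j)) k xs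
    (set_nth 0 (set_nth 0 xs i 0) j (nth 0 xs j + nth 0 xs i)).
Proof.
move=> neq.
pose F m := set_nth 0 (set_nth 0 xs i m) j (nth 0 xs j + (nth 0 xs i - m)).
apply: (@run_eq _ _ (F (nth 0 xs i)) (F 0)); last 2 first.
- move=> r; rewrite !nth_set_nth /= nth_set_nth /= subnn addn0.
  by case: eqP => [->|_] //; case: eqP => [->|].
- by move=> r; rewrite /F subn0.
apply: run_while_iter => m lem.
  by rewrite !nth_set_nth /= (negbTE neq) nth_set_nth /= eqxx.
apply: run_eq (run_inc _ _ _) _ _ => r //.
by rewrite /F; nth_cases.
Qed.

Definition clear_reg i := While i (Dec i).

Lemma run_clear k i xs : runs (clear_reg (k + i)) k xs (set_nth 0 xs i 0).
Proof.
have [n] := ubnP (nth 0 xs i); elim: n xs => // n IH xs lt.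
case E: (nth 0 xs i) => [|m].
  apply: run_eq (run_while0 _ _ E) _ _ => r //; rewrite nth_set_nth /=.
  by case: eqP => // ->.
apply: (run_whileS E (run_dec _ _ _)).
apply: run_eq (IH _ _) _ _ => // [|r]; last by nth_cases.
by rewrite !nth_set_nth /= eqxx; lia.
Qed.

(** Reading a register destroys it, so the value is copied twice, once to the top [m] and once to
    the scratch cell [m.+1], from which the source is restored. *)
Definition push k m i :=
  Seq (While (k + i) (Seq (Inc (k + m)) (Inc (k + m.+1))))
      (move_reg (k + m.+1) (k + i)).

Lemma run_push k i xs : i < size xs ->
  runs (push k (size xs) i) k xs (rcons xs (nth 0 xs i)).
Proof.
have [m sm] : {m | m = size xs} by exists (size xs).
rewrite -sm => lti; set n := nth 0 xs i.
pose F p := set_nth 0 (set_nth 0 (set_nth 0 xs m (n - p)) m.+1 (n - p)) i p.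
apply: (@run_seq _ _ _ _ (F 0)).
  apply: (@run_eq _ _ (F n) (F 0)) => // [|r]; last first.
    rewrite /F subnn; nth_cases.
  apply: run_while_iter => [p _|p ltp]; first by rewrite /F; nth_cases.
  apply: run_eq (run_seq (run_inc _ _ _) (run_inc _ _ _)) _ _ => r //.
  by rewrite /F; nth_cases.
apply: run_eq (run_move _ _ _) _ _ => [|r //|r]; first by lia.
rewrite /F; nth_cases.
Qed.

Definition put k m i := Seq (clear_reg (k + i)) (move_reg (k + m) (k + i)).

Lemma run_put k i xs y : i < size xs ->
  runs (put k (size xs) i) k (rcons xs y) (set_nth 0 xs i y).
Proof.
move=> lti; apply: run_seq (run_clear _ _ _) _.
apply: run_eq (run_move _ _ _) _ _ => [|r //|r]; first by lia.
nth_cases.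
Qed.

(** This is the cons operation of [CodeSeq.code]; pickled lists, pairs and sums are all built from
    it and 0. *)
Definition pcons a b := 2 ^ a * b.*2.+1.

Lemma run_move' k i j xs ys : i != j ->
  nth 0 ys =1 nth 0 (set_nth 0 (set_nth 0 xs i 0) j (nth 0 xs j + nth 0 xs i)) ->
  runs (move_reg (k + i) (k + j)) k xs ys.
Proof. by move=> neq E; apply: run_eq (run_move k xs neq) _ _ => // r; rewrite E. Qed.

Lemma run_inc' k i xs ys :
  nth 0 ys =1 nth 0 (set_nth 0 xs i (nth 0 xs i).+1) ->
  runs (Inc (k + i)) k xs ys.
Proof. by move=> E; apply: run_eq (run_inc k i xs) _ _ => // r; rewrite E. Qed.

Lemma run_dec' k i xs ys :
  nth 0 ys =1 nth 0 (set_nth 0 xs i (nth 0 xs i).-1) ->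
  runs (Dec (k + i)) k xs ys.
Proof. by move=> E; apply: run_eq (run_dec k i xs) _ _ => // r; rewrite E. Qed.

Lemma run_clear' k i xs ys :
  nth 0 ys =1 nth 0 (set_nth 0 xs i 0) -> runs (clear_reg (k + i)) k xs ys.
Proof. by move=> E; apply: run_eq (run_clear k i xs) _ _ => // r; rewrite E. Qed.

Lemma run_while0' c k i xs ys : nth 0 xs i = 0 -> nth 0 ys =1 nth 0 xs ->
  runs (While (k + i) c) k xs ys.
Proof. by move=> E0 E; apply: run_eq (run_while0 c k E0) _ _ => // r; rewrite E. Qed.

Ltac frame :=
  let r := fresh "r" in move=> r;
  do 8 (case: r => [|r]; [by move=> /=; first [reflexivity|lia]|]);
  by rewrite /= ?nth_nil.

(** * Programs that form and split pairs of numbers *)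

Definition double_reg i t := Seq (While i (Seq (Inc t) (Inc t))) (move_reg t i).

Lemma run_double k x a : runs (double_reg (k + 0) (k + 2)) k [:: x; a] [:: x.*2; a].
Proof.
apply: (@run_seq _ _ _ _ [:: 0; a; x.*2]).
  apply: (@run_eq _ _ [:: x; a; 0] [:: 0; a; x.*2]); [|by frame|by frame].
  pose F m := [:: m; a; (x - m).*2].
  apply: (@run_eq _ _ (F x) (F 0)); [|by rewrite /F; frame|by rewrite /F; frame].
  apply: run_while_iter => [//|m ltm].
  by apply: run_seq (run_inc _ _ _) _; apply: run_inc'; frame.
by apply: run_move' => //; frame.
Qed.

Definition mkpair k :=
  Seq (Seq (double_reg (k + 0) (k + 2)) (Inc (k + 0)))
      (While (k + 1) (double_reg (k + 0) (k + 2))).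

Lemma run_mkpair k a b : runs (mkpair k) k [:: b; a] [:: pcons a b].
Proof.
apply: (@run_seq _ _ _ _ [:: b.*2.+1; a]).
  apply: run_seq (run_double _ _ _) _.
  by apply: run_inc'; frame.
pose F m := [:: 2 ^ (a - m) * b.*2.+1; m].
apply: (@run_eq _ _ (F a) (F 0)).
- apply: run_while_iter => [//|m ltm].
  have -> : F m = [:: (2 ^ (a - m.+1) * b.*2.+1).*2; m].
    by rewrite /F -[(_ * _).*2]mul2n mulnA -expnS -subSn // subSS.
  exact: run_double.
- by rewrite /F subnn mul1n.
- by rewrite /F subn0 /pcons; frame.
Qed.

Definition push_pair k m i j :=
  Seq (Seq (push k m j) (push k m.+1 i)) (mkpair (k + m)).

Lemma run_push_pair k i j xs : i < size xs -> j < size xs ->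
  runs (push_pair k (size xs) i j) k xs
    (rcons xs (pcons (nth 0 xs i) (nth 0 xs j))).
Proof.
move=> lti ltj; apply: run_seq.
  apply: run_seq (run_push _ ltj) _.
  have := @run_push k i (rcons xs (nth 0 xs j)).
  by rewrite size_rcons nth_rcons lti => R; apply/R/leqW.
rewrite -!cats1 -catA; apply: run_shift; exact: run_mkpair.
Qed.

(* Frame of [halve] and [split_pair]: [n; a; b; q; r; e], where [q] and [r]   *)
(* receive the quotient and remainder of [n] by 2 and [e] is a flag; [a] and  *)
(* [b] receive the components of the pair coded by [n].                       *)
Definition halve k :=
  While (k + 0) (Seq (Inc (k + 5)) (Seq
    (While (k + 4) (Seq (Dec (k + 5)) (Inc (k + 3)))) (move_reg (k + 5) (k + 4)))).

(** Each unit taken from [n] flips the remainder, and the quotient grows when the remainder was 1;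
    the flag carries the new remainder. General [q] and [r] make the induction go through. *)
Lemma run_halve k n a b q (r : bool) :
  runs (halve k) k [:: n; a; b; q; nat_of_bool r; 0]
    [:: 0; a; b; q + (n + r)./2; nat_of_bool (odd (n + r)); 0].
Proof.
elim: n q r => [|n IH] q r.
  by apply: run_while0' => //; case: r; frame.
apply: (run_whileS (m := n) (ys := [:: n; a; b; q + r; nat_of_bool (~~ r); 0])) => //.
  apply: (run_seq (run_inc _ _ _)) => /=.
  case: r => /=.
    apply: (@run_seq _ _ _ _ [:: n; a; b; q.+1; 0; 0]); last first.
      by apply: run_move' => //; frame.
    apply: (run_whileS (m := 0) (ys := [:: n; a; b; q.+1; 0; 0])) => //.
      by apply: run_seq (run_dec _ _ _) _; apply: run_inc'; frame.
    exact: run_while0.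
  apply: (@run_seq _ _ _ _ [:: n; a; b; q; 0; 1]); first exact: run_while0.
  by apply: run_move' => //; frame.
have -> : q + (n.+1 + r)./2 = q + r + (n + ~~ r)./2 by case: r => /=; lia.
have -> : odd (n.+1 + r) = odd (n + ~~ r) by case: r => /=; lia.
exact: IH.
Qed.

Definition split_pair k :=
  While (k + 0) (Seq (Seq (Inc (k + 0)) (halve k)) (Seq (Inc (k + 5)) (Seq
    (While (k + 4) (Seq (Dec (k + 5)) (move_reg (k + 3) (k + 2))))
    (While (k + 5) (Seq (move_reg (k + 3) (k + 0)) (Inc (k + 1))))))).

Lemma pcons_gt0 a b : 0 < pcons a b.
Proof. by rewrite /pcons muln_gt0 expn_gt0. Qed.

(** The code [2 ^ x * y.*2.+1] is halved until an odd number is met, each halving being counted; the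
    quotient of the odd number is [y]. The loop test consumes one unit, which the body first
    restores. *)
Lemma run_split_pair k x a y :
  runs (split_pair k) k [:: pcons x y; a] [:: 0; a + x; y].
Proof.
elim: x a => [|x IH] a.
  apply: (run_whileS (m := y.*2) (ys := [:: 0; a; y])).
  - by rewrite /pcons mul1n.
  - apply: run_seq.
      apply: run_seq (run_inc _ _ _) _.
      apply: (@run_eq _ _ [:: y.*2.+1; a; 0; 0; nat_of_bool false; 0] [:: 0; a; 0; y; 1; 0]).
      + apply: run_eq (run_halve _ _ _ _ _ _) _ _ => // r.
        by rewrite addn0 /= odd_double uphalf_double.
      + by frame.
      + by move=> r.
    apply: (run_seq (run_inc _ _ _)) => /=.
    apply: (@run_seq _ _ _ _ [:: 0; a; y; 0; 0; 0]); last first.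
      by apply: run_while0' => //; frame.
    apply: (run_whileS (m := 0) (ys := [:: 0; a; y; 0; 0; 0])) => //.
      apply: run_seq (run_dec _ _ _) _.
      by apply: run_move' => //; frame.
    exact: run_while0.
  - by apply: run_while0' => //; frame.
have E : pcons x.+1 y = (pcons x y).*2 by rewrite /pcons expnS -mulnA mul2n.
apply: (run_whileS (m := (pcons x y).*2.-1) (ys := [:: pcons x y; a.+1])).
- by rewrite /= E prednK // double_gt0 pcons_gt0.
- apply: run_seq.
    apply: run_seq (run_inc _ _ _) _.
    apply: (@run_eq _ _ [:: pcons x.+1 y; a; 0; 0; nat_of_bool false; 0]
                        [:: 0; a; 0; pcons x y; 0; 0]).
    + apply: run_eq (run_halve _ _ _ _ _ _) _ _ => // r.
      by rewrite addn0 /= E odd_double doubleK.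
    + by rewrite E; have := pcons_gt0 x y => h; frame.
    + by move=> r.
  apply: (run_seq (run_inc _ _ _)) => /=.
  apply: (@run_seq _ _ _ _ [:: 0; a; 0; pcons x y; 0; 1]); first exact: run_while0.
  apply: (run_whileS (m := 0) (ys := [:: pcons x y; a.+1; 0; 0; 0; 0])) => //.
    apply: (@run_seq _ _ _ _ [:: pcons x y; a; 0; 0; 0; 0]).
      by apply: run_move' => //; frame.
    by apply: run_inc'; frame.
  by apply: run_while0' => //; frame.
by rewrite -(addSnnS a x); apply: IH.
Qed.

Definition unpair k :=
  Seq (split_pair k) (Seq (move_reg (k + 1) (k + 0)) (move_reg (k + 2) (k + 1))).

Definition chd n := head 0 (CodeSeq.decode n).
Definition ctl n := CodeSeq.code (behead (CodeSeq.decode n)).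

Lemma decode_pcons a b : CodeSeq.decode (pcons a b) = a :: CodeSeq.decode b.
Proof.
rewrite -[X in pcons a X]CodeSeq.decodeK.
exact: (CodeSeq.codeK (a :: CodeSeq.decode b)).
Qed.

Lemma chd_pcons a b : chd (pcons a b) = a.
Proof. by rewrite /chd decode_pcons. Qed.

Lemma ctl_pcons a b : ctl (pcons a b) = b.
Proof. by rewrite /ctl decode_pcons CodeSeq.decodeK. Qed.

Lemma run_unpair k n : runs (unpair k) k [:: n] [:: chd n; ctl n].
Proof.
apply: (@run_seq _ _ _ _ [:: 0; chd n; ctl n]); last first.
  apply: (@run_seq _ _ _ _ [:: chd n; 0; ctl n]).
    by apply: run_move' => //; frame.
  by apply: run_move' => //; frame.
case: n => [|n].
  (* Zero codes the empty list: the splitting loop is not entered and both components are 0 by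
     default. *)
  rewrite -[chd 0]/0 -[ctl 0]/0.
  by apply: run_while0' => //; frame.
have -> : n.+1 = pcons (chd n.+1) (ctl n.+1).
  rewrite -[LHS]CodeSeq.decodeK /chd /ctl.
  by have := CodeSeq.decodeK n.+1; case: CodeSeq.decode.
rewrite chd_pcons ctl_pcons.
by apply: run_eq (run_split_pair k (chd n.+1) 0 (ctl n.+1)) _ _; frame.
Qed.

(** The program may depend on [k], since registers are addressed absolutely; it must work above any
    [k] occupied registers, so that it can be called inside a larger frame. *)
Definition cfun (f : nat -> nat) :=
  forall k, exists c, forall x, runs c k [:: x] [:: f x].

Lemma cfun_ext f g : f =1 g -> cfun f -> cfun g.
Proof. by move=> E cf k; have [c Hc] := cf k; exists c => x; rewrite -E. Qed.

Lemma cfun_id : cfun id.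
Proof.
move=> k; exists (Seq (Inc (k + 0)) (Dec (k + 0))) => x.
by apply: run_seq (run_inc _ _ _) _; apply: run_dec'; frame.
Qed.

Lemma cfun_comp f g : cfun f -> cfun g -> cfun (f \o g).
Proof.
move=> cf cg k; have [c Hc] := cf k; have [d Hd] := cg k.
by exists (Seq d c) => x; apply: run_seq (Hd x) (Hc _).
Qed.

Lemma cfun_succ : cfun succn.
Proof.
by move=> k; exists (Inc (k + 0)) => x; apply: run_inc'; frame.
Qed.

Lemma cfun_const n : cfun (fun=> n).
Proof.
elim: n => [|n IH]; last exact: (cfun_comp cfun_succ IH).
move=> k; exists (clear_reg (k + 0)) => x.
by apply: run_clear'; frame.
Qed.

Lemma cfun_chd : cfun chd.
Proof.
move=> k; exists (Seq (unpair k) (clear_reg (k + 1))) => n.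
apply: run_seq (run_unpair _ _) _.
by apply: run_clear'; frame.
Qed.

Lemma cfun_ctl : cfun ctl.
Proof.
move=> k; exists (Seq (unpair k) (Seq (clear_reg (k + 0)) (move_reg (k + 1) (k + 0)))) => n.
apply: run_seq (run_unpair _ _) _.
apply: run_seq (run_clear _ _ _) _.
by apply: run_move' => //; frame.
Qed.

Lemma cfun_push f : cfun f -> forall k m i, i < m -> exists c,
  forall xs, size xs = m -> runs c k xs (rcons xs (f (nth 0 xs i))).
Proof.
move=> cf k m i lti; have [c Hc] := cf (k + m).
exists (Seq (push k m i) c) => xs sxs; rewrite -sxs in lti Hc *.
apply: run_seq (run_push _ lti) _.
by rewrite -!cats1; apply: run_shift.
Qed.

Lemma cfun_pcons f g : cfun f -> cfun g -> cfun (fun x => pcons (f x) (g x)).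
Proof.
move=> cf cg k; have [c Hc] := cfun_push cf k (ltn0Sn 0).
have [d Hd] := cfun_push cg k (ltn0Sn 1).
exists (Seq (Seq c d) (Seq (push_pair k 3 1 2)
  (Seq (put k 3 0) (Seq (clear_reg (k + 1)) (clear_reg (k + 2)))))) => x.
apply: run_seq.
  by apply: run_seq (Hc [:: x] _) (Hd [:: x; f x] _).
apply: run_seq (@run_push_pair k 1 2 [:: x; f x; g x] _ _) _ => //.
apply: run_seq (@run_put k 0 [:: x; f x; g x] _ _) _ => //.
apply: run_seq (run_clear _ _ _) _.
by apply: run_clear'; frame.
Qed.

Fixpoint loop (f : nat -> nat -> nat) n acc :=
  if n is m.+1 then loop f m (f m acc) else acc.

(** The indices passed to the body descend from [n x - 1] to 0, as the loop counter does. The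
    argument [x] stays in the frame and is paired anew with counter and accumulator at each
    round. *)
Lemma cfun_loop s n b : cfun s -> cfun n -> cfun b ->
  cfun (fun x => loop (fun m acc => s (pcons x (pcons m acc))) (n x) (b x)).
Proof.
move=> cs cn cb k; have [c Hc] := cfun_push cn k (ltn0Sn 0).
have [d Hd] := cfun_push cb k (ltn0Sn 1).
have [e He] := cfun_push cs k (ltnSn 4).
pose body := Seq (Seq (push_pair k 3 1 2) (push_pair k 4 0 3))
  (Seq e (Seq (put k 5 2) (Seq (clear_reg (k + 3)) (clear_reg (k + 4))))).
exists (Seq (Seq c d) (Seq (While (k + 1) body) (put k 2 0))) => x.
apply: run_seq; first by apply: run_seq (Hc [:: x] _) (Hd [:: x; n x] _).
move: (n x) (b x) => {c d Hc Hd} m acc /=.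
pose g m acc := s (pcons x (pcons m acc)).
rewrite -/(g _ _) -/(loop g m acc).
apply: (@run_seq _ _ _ _ [:: x; 0; loop g m acc]); last first.
  by apply: run_eq (@run_put k 0 [:: x; 0] _ _) _ _ => //; frame.
elim: m acc => [|m IH] acc; first exact: run_while0.
apply: (run_whileS (m := m) (ys := [:: x; m; g m acc])) => //.
apply: run_seq.
  by apply: run_seq (@run_push_pair k 1 2 [:: x; m; acc] _ _)
                    (@run_push_pair k 0 3 [:: x; m; acc; pcons m acc] _ _).
apply: run_seq (He _ _) _ => //=.
apply: run_seq (@run_put k 2 [:: x; m; acc; pcons m acc; pcons x (pcons m acc)] _ _) _ => //.
apply: run_seq (run_clear _ _ _) _.
by apply: run_clear'; frame.
Qed.

Lemma cfun_machine f : cfun f ->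
  exists p, forall n, exists t, cm_halts p n t /\ (cm_run p n t).2 0 = f n.
Proof.
(* One register is reserved below: register 0 receives the output, and register 1, where the frame
   starts, holds the input. *)
move=> cf; have [c Hc] := cf 1.
pose d := Seq c (move_reg (0 + 1) (0 + 0)).
exists (compile d 0 (cmd_size d)) => n.
have R : runs d 0 [:: 0; n] [:: f n].
  apply: (@run_seq _ _ _ _ [:: 0; f n]).
    by apply: (@run_shift c 0 [:: 0]); apply: Hc.
  by apply: run_move' => //; frame.
have [t _] := compile_sound (runE R (l := [::]) erefl) [::] [::] (cmd_size d).
rewrite cats0 [[::] ++ _]/= => E; exists t.
have E0 : cm_run (compile d 0 (cmd_size d)) n t = (cmd_size d, st [::] [:: f n]).
  rewrite -E /cm_run; congr (iter _ _ (_, _)).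
  apply: functional_extensionality => -[|[|r]] //.
  by rewrite /st /= nth_nil.
by rewrite /cm_halts E0 size_compile leqnn.
Qed.

Lemma cm_halts_later p n t t' : t <= t' -> cm_halts p n t -> cm_halts p n t'.
Proof.
move=> /subnK <-; elim: (t' - t) => // m IH /IH; rewrite /cm_halts.
rewrite addSn /cm_run iterS; case: (iter _ _ _) => pc rg /= le.
by rewrite nth_default // size_map.
Qed.

(** Unbounded minimization. A run that never stops has no [exec] derivation, so the failing case is
    argued on the compiled machine, one round of the loop at a time. *)
Lemma cfun_search b : cfun b ->
  re_nat (fun n => exists t, b (pcons n t) != 0).
Proof.
move=> cb; have [d Hd] := cfun_push cb 1 (ltnSn 3).
pose body := Seq (Seq (push_pair 1 3 0 1) d) (Seq (Seq (clear_reg (1 + 3)) (Inc (1 + 2)))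
   (Seq (While (1 + 4) (Seq (clear_reg (1 + 4)) (clear_reg (1 + 2)))) (Inc (1 + 1)))).
have Hbody n t : runs body 1 [:: n; t; 0] [:: n; t.+1; nat_of_bool (b (pcons n t) == 0)].
  apply: run_seq.
    apply: run_seq (@run_push_pair 1 0 1 [:: n; t; 0] _ _) _ => //.
    exact: Hd.
  apply: run_seq; first by apply: run_seq (run_clear _ _ _) (run_inc _ _ _).
  rewrite /=; apply: (@run_seq _ _ _ _ [:: n; t; nat_of_bool (b (pcons n t) == 0)]).
    case: (b _) => [|v].
      by apply: run_while0' => //; frame.
    apply: (run_whileS (m := v) (ys := [:: n; t; 0; 0; 0])) => //.
      by apply: run_seq (run_clear _ _ _) _; apply: run_clear'; frame.
    by apply: run_while0' => //; frame.
  by apply: run_inc'; frame.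
pose prog := Seq (Inc (1 + 2)) (While (1 + 2) body).
pose ex := cmd_size prog; pose p := compile prog 0 ex.
have st0 n : (fun x => if x == 1 then n else 0) = st [:: 0] [:: n; 0; 0].
  apply: functional_extensionality => -[|[|[|[|r]]]] //.
  by rewrite /st /= nth_nil.
exists p => n; split=> [[t1 bt1]|[t0 halt0]].
  have [t bt mint] := ex_minnP (ex_intro (fun t => b (pcons n t) != 0) t1 bt1).
  have R : runs prog 1 [:: n; 0; 0] [:: n; t.+1; 0].
    apply: run_seq (run_inc _ _ _) _ => /=.
    have ltb j : j < t -> b (pcons n j) == 0.
      by move=> ltj; apply: contraTT ltj => /mint; rewrite -leqNgt.
    suff H j : j <= t -> runs (While (1 + 2) body) 1 [:: n; t - j; 1] [:: n; t.+1; 0].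
      by have := H t (leqnn t); rewrite subnn.
    elim: j => [_|j IH ltj].
      rewrite subn0; apply: (run_whileS (m := 0)) => //; first exact: Hbody.
      by rewrite (negbTE bt); apply: run_while0.
    apply: (run_whileS (m := 0)) => //; first exact: Hbody.
    by rewrite ltb -?subSn ?subSS; [apply: IH; apply: ltnW|lia..].
  have [t0 _] := compile_sound (runE R (l := [:: 0]) erefl) [::] [::] ex.
  rewrite cats0 -/p => E; exists t0.
  by rewrite /cm_halts /cm_run st0 E size_compile.
case: (boolP [exists t : 'I_t0.+1, b (pcons n t) != 0]) => [/existsP[t bt]|/existsPn H].
  by exists t.
(* All candidates up to [t0] fail, so at some time not before [t0] the machine is back at the loop
   head, address 1; it cannot have halted at [t0]. *)
exfalso; suff [t ge1] : exists2 t, t0 <= t & (cm_run p n t).1 = 1.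
  by have := cm_halts_later ge1 halt0; rewrite /cm_halts => le E; rewrite E in le.
suff K j : j <= t0 -> exists2 t, j <= t & cm_run p n t = (1, st [:: 0] [:: n; j; 1]).
  by have [t le E] := K t0 (leqnn _); exists t => //; rewrite E.
have pE : p = [:: CM_INC (1 + 2) 1; CM_DEC (1 + 2) 2 ex] ++ compile body 2 1 ++ [::].
  by rewrite cats0.
elim: j => [_|j IH ltj].
  exists 1 => //; rewrite /cm_run st0 pE /=; congr pair.
  by apply: functional_extensionality => -[|[|[|[|[|r]]]]] //.
have [t le E] := IH (ltnW ltj).
have [t' _] := compile_sound (runE (Hbody n j) (l := [:: 0]) erefl)
  [:: CM_INC (1 + 2) 1; CM_DEC (1 + 2) 2 ex] [::] 1.
rewrite -pE => E'; exists (t' + (1 + t)); first by lia.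
rewrite /cm_run iterD iterD -/(cm_run p n t) E [iter 1 _ _]/=.
have := H (Ordinal (leqW ltj : j < t0.+1)); rewrite negbK /= => /eqP bj.
rewrite bj eqxx /= in E'; rewrite -E'; congr (iter _ _ (_, _)).
by apply: functional_extensionality => -[|[|[|[|[|r]]]]] //.
Qed.

(** * Computable functions on countable types *)

Lemma cfun_pcons_comp s f g : cfun s -> cfun f -> cfun g ->
  cfun (fun x => s (pcons (f x) (g x))).
Proof. by move=> cs cf cg; apply: (cfun_comp cs); apply: cfun_pcons. Qed.

(** A loop of [b x] rounds, each overwriting the accumulator by [g x]; with no round the initial
    value [f x] survives. *)
Lemma cfun_if b f g : cfun b -> cfun f -> cfun g ->
  cfun (fun x => if b x == 0 then f x else g x).
Proof.
move=> cb cf cg; apply: cfun_ext (cfun_loop (cfun_comp cg cfun_chd) cb cf) => x.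
case: (b x) => //= n; elim: n (f x) => [|n IH] acc /=; last exact: IH.
by rewrite chd_pcons.
Qed.

(** Nothing is required of the numerical function outside the codes of elements of [A]. *)
Definition comput (A B : countType) (g : A -> B) :=
  exists2 f, cfun f & forall x, f (pickle x) = pickle (g x).

Section Comput.
Implicit Types A B C D X Y : countType.

Lemma pickle_nat (n : nat) : pickle n = n. Proof. by []. Qed.

Lemma pickle_pair A B (x : A) (y : B) :
  pickle (x, y) = pcons (pickle x) (pcons (pickle y) 0).
Proof. by []. Qed.

Lemma pickle_cons X (x : X) (s : seq X) :
  pickle (x :: s) = pcons (pickle x) (pickle s).
Proof. by []. Qed.

Lemma pickle_seqE X (s : seq X) : pickle s = CodeSeq.code (map pickle s).
Proof. by []. Qed.

Lemma pickle_inl A B (x : A) :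
  pickle (inl x : A + B) = pcons (pcons (pickle x) 0) (pcons 0 0).
Proof. by []. Qed.

Lemma pickle_inr A B (x : B) :
  pickle (inr x : A + B) = pcons 0 (pcons (pcons (pickle x) 0) 0).
Proof. by []. Qed.

Lemma comput_ext A B (f g : A -> B) : f =1 g -> comput f -> comput g.
Proof. by move=> E [r cr Hr]; exists r => // x; rewrite Hr E. Qed.

(** Only codes matter, so a change of type that keeps the code costs nothing; this covers formulae
    and their tokens, numbers and the lists they code, ordinals and their values. *)
Lemma comput_code A B C (f : A -> B) (g : A -> C) :
  (forall x, pickle (f x) = pickle (g x)) -> comput f -> comput g.
Proof. by move=> E [r cr Hr]; exists r => // x; rewrite Hr E. Qed.

Lemma comput_id A : comput (fun x : A => x).
Proof. by exists id; first exact: cfun_id. Qed.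

Lemma comput_const A B (b : B) : comput (fun _ : A => b).
Proof. by exists (fun=> pickle b); first exact: cfun_const. Qed.

Lemma comput_comp A B C (g : B -> C) (f : A -> B) :
  comput g -> comput f -> comput (fun x => g (f x)).
Proof.
move=> [r cr Hr] [s cs Hs]; exists (r \o s); first exact: cfun_comp.
by move=> x; rewrite /= Hs Hr.
Qed.

Lemma comput_pair A B C (f : A -> B) (g : A -> C) :
  comput f -> comput g -> comput (fun x => (f x, g x)).
Proof.
move=> [r cr Hr] [s cs Hs]; exists (fun n => pcons (r n) (pcons (s n) 0)).
  by apply: cfun_pcons => //; apply: cfun_pcons => //; apply: cfun_const.
by move=> x; rewrite Hr Hs.
Qed.

Lemma comput_fst A B C (f : A -> B * C) : comput f -> comput (fun x => (f x).1).
Proof.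
apply: comput_comp; exists chd; first exact: cfun_chd.
by case=> x y; apply: chd_pcons.
Qed.

Lemma comput_snd A B C (f : A -> B * C) : comput f -> comput (fun x => (f x).2).
Proof.
apply: comput_comp; exists (chd \o ctl); first exact: cfun_comp cfun_chd cfun_ctl.
by case=> x y; rewrite /comp pickle_pair ctl_pcons; apply: chd_pcons.
Qed.

Lemma comput_app2 A B C X (h : B -> C -> X) (f : A -> B) (g : A -> C) :
  comput (fun z : B * C => h z.1 z.2) -> comput f -> comput g ->
  comput (fun x => h (f x) (g x)).
Proof.
by move=> ch cf cg; exact: (comput_comp ch (comput_pair cf cg)).
Qed.

Lemma comput_app3 A B C D X (h : B -> C -> D -> X) (f : A -> B) (g : A -> C)
    (k : A -> D) :
  comput (fun z : B * C * D => h z.1.1 z.1.2 z.2) ->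
  comput f -> comput g -> comput k -> comput (fun x => h (f x) (g x) (k x)).
Proof.
by move=> ch cf cg ck; exact: (comput_comp ch (comput_pair (comput_pair cf cg) ck)).
Qed.

Lemma comput_if A B (b : A -> bool) (f g : A -> B) :
  comput b -> comput f -> comput g -> comput (fun x => if b x then f x else g x).
Proof.
move=> [r cr Hr] [s cs Hs] [t ct Ht].
exists (fun n => if r n == 0 then t n else s n); first exact: cfun_if.
by move=> x; rewrite Hr Hs Ht; case: (b x).
Qed.

Lemma comput_pickle A B (f : A -> B) : comput f -> comput (fun x => pickle (f x)).
Proof. exact: comput_code. Qed.

Lemma comput_succ A (f : A -> nat) : comput f -> comput (fun x => (f x).+1).
Proof. by apply: comput_comp; exists succn; first exact: cfun_succ. Qed.

Lemma comput_iter A B (n : A -> nat) (s : A -> B -> B) (b : A -> B) :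
  comput n -> comput (fun z : A * B => s z.1 z.2) -> comput b ->
  comput (fun x => iter (n x) (s x) (b x)).
Proof.
move=> [rn cn Hn] [rs cs Hs] [rb cb Hb].
(* The step of [loop] also receives the counter; it is dropped here and the pair of parameter and
   accumulator is coded afresh. *)
pose s' := fun p => rs (pcons (chd p) (pcons (ctl (ctl p)) 0)).
exists (fun x => loop (fun m acc => s' (pcons x (pcons m acc))) (rn x) (rb x)).
  apply: cfun_loop => //; apply: cfun_pcons_comp => //; first exact: cfun_chd.
  apply: cfun_pcons; last exact: cfun_const.
  exact: cfun_comp cfun_ctl cfun_ctl.
move=> x; rewrite Hn Hb pickle_nat.
elim: (n x) (b x) => // m IH y.
rewrite iterSr -IH /= /s' chd_pcons !ctl_pcons; congr loop.
exact: (Hs (x, y)).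
Qed.

Lemma comput_pred A (f : A -> nat) : comput f -> comput (fun x => (f x).-1).
Proof.
apply: comput_comp.
(* Kleene's predecessor: after [n] rounds the pair holds [n.-1] and [n]. *)
apply: (@comput_ext _ _ (fun n => (iter n (fun s => (s.2, s.2.+1)) (0, 0)).1)).
  move=> n; suff -> : iter n (fun s => (s.2, s.2.+1)) (0, 0) = (n.-1, n) by [].
  by elim: n => //= n ->.
apply: comput_fst.
apply: (@comput_iter _ _ id (fun _ (s : nat * nat) => (s.2, s.2.+1)) (fun=> (0, 0))).
- exact: comput_id.
- have c2 : comput (fun z : nat * (nat * nat) => z.2.2).
    by do 2!apply: comput_snd; apply: comput_id.
  by apply: comput_pair => //; apply: comput_succ.
- exact: comput_const.
Qed.

Lemma comput_nat_case A B (n : A -> nat) (f : A -> B) (g : A -> nat -> B) :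
  comput n -> comput f -> comput (fun z : A * nat => g z.1 z.2) ->
  comput (fun x => if n x is m.+1 then g x m else f x).
Proof.
move=> cn cf cg; have [r cr Hr] := cn.
have [s cs Hs] := cf.
have [t ct Ht] := comput_comp cg (comput_pair (@comput_id A) (comput_pred cn)).
exists (fun x => if r x == 0 then s x else t x); first exact: cfun_if.
move=> x; rewrite Hr Hs Ht pickle_nat.
by case: (n x).
Qed.

Lemma comput_sub A (f g : A -> nat) :
  comput f -> comput g -> comput (fun x => f x - g x).
Proof.
move=> cf cg; apply: (@comput_ext _ _ (fun x => iter (g x) predn (f x))).
  by move=> x; rewrite iter_predn.
by apply: comput_iter => //; apply/comput_pred/comput_snd/comput_id.
Qed.

Lemma comput_leq A (f g : A -> nat) :
  comput f -> comput g -> comput (fun x => f x <= g x).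
Proof.
move=> cf cg.
apply: (@comput_ext _ _ (fun x => if f x - g x is _.+1 then false else true)).
  by move=> x; rewrite -subn_eq0; case: (_ - _).
by apply: comput_nat_case; [apply: comput_sub|apply: comput_const|apply: comput_const].
Qed.

Lemma comput_max A (f g : A -> nat) :
  comput f -> comput g -> comput (fun x => maxn (f x) (g x)).
Proof.
move=> cf cg; apply: comput_if => //.
by apply: comput_leq => //; apply: comput_succ.
Qed.

Lemma comput_and A (f g : A -> bool) :
  comput f -> comput g -> comput (fun x => f x && g x).
Proof. by move=> cf cg; apply: comput_if => //; apply: comput_const. Qed.

Lemma comput_or A (f g : A -> bool) :
  comput f -> comput g -> comput (fun x => f x || g x).
Proof. by move=> cf cg; apply: comput_if => //; apply: comput_const. Qed.

Lemma comput_neg A (f : A -> bool) : comput f -> comput (fun x => ~~ f x).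
Proof. by move=> cf; apply: comput_if => //; apply: comput_const. Qed.

Lemma comput_eq A B (f g : A -> B) :
  comput f -> comput g -> comput (fun x => f x == g x).
Proof.
move=> cf cg.
apply: (@comput_ext _ _ (fun x =>
  (pickle (f x) <= pickle (g x)) && (pickle (g x) <= pickle (f x)))).
  by move=> x; rewrite -eqn_leq (inj_eq (pcan_inj pickleK)).
by apply: comput_and; apply: comput_leq; apply: comput_pickle.
Qed.

Lemma comput_cons A X (f : A -> X) (s : A -> seq X) :
  comput f -> comput s -> comput (fun x => f x :: s x).
Proof.
move=> [r cr Hr] [t ct Ht]; exists (fun n => pcons (r n) (t n)).
  exact: cfun_pcons.
by move=> x; rewrite Hr Ht.
Qed.

Lemma comput_seq_case A X B (s : A -> seq X) (f : A -> B)
    (g : A -> X -> seq X -> B) :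
  comput s -> comput f -> comput (fun z : A * X * seq X => g z.1.1 z.1.2 z.2) ->
  comput (fun x => if s x is y :: l then g x y l else f x).
Proof.
move=> [rs cs Hs] [rf cf Hf] [rg cg Hg].
exists (fun n => if rs n == 0 then rf n else
  rg (pcons (pcons n (pcons (chd (rs n)) 0)) (pcons (ctl (rs n)) 0))).
  apply: cfun_if => //; apply: cfun_pcons_comp => //; apply: cfun_pcons => //.
  - exact: cfun_id.
  - apply: cfun_pcons; last exact: cfun_const.
    exact: (cfun_comp cfun_chd).
  - exact: (cfun_comp cfun_ctl).
  - exact: cfun_const.
move=> x; rewrite Hs Hf; case: (s x) => // y l.
rewrite pickle_cons.
have := pcons_gt0 (pickle y) (pickle l); rewrite lt0n => /negbTE->.
by rewrite chd_pcons ctl_pcons; apply: (Hg (x, y, l)).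
Qed.

(** A sum is coded by a list of two lists, one of which is empty; a left injection is recognized by
    a nonzero head. *)
Lemma comput_sum_case A X Y B (s : A -> X + Y) (f : A -> X -> B) (g : A -> Y -> B) :
  comput s -> comput (fun z : A * X => f z.1 z.2) ->
  comput (fun z : A * Y => g z.1 z.2) ->
  comput (fun x => match s x with inl y => f x y | inr y => g x y end).
Proof.
move=> [rs cs Hs] [rf cf Hf] [rg cg Hg].
exists (fun n => if chd (rs n) == 0
  then rg (pcons n (pcons (chd (chd (ctl (rs n)))) 0))
  else rf (pcons n (pcons (chd (chd (rs n))) 0))).
  have c1 := cfun_comp cfun_chd cs.
  have c2 := cfun_comp cfun_chd c1.
  have c3 := cfun_comp cfun_chd (cfun_comp cfun_chd (cfun_comp cfun_ctl cs)).
  apply: cfun_if => //; apply: cfun_pcons_comp; rewrite //; try exact: cfun_id.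
    by apply: cfun_pcons => //; apply: cfun_const.
  by apply: cfun_pcons => //; apply: cfun_const.
move=> x; rewrite Hs; case: (s x) => y.
  rewrite pickle_inl !chd_pcons.
  have := pcons_gt0 (pickle y) 0; rewrite lt0n => /negbTE->.
  exact: (Hf (x, y)).
rewrite pickle_inr ctl_pcons !chd_pcons.
exact: (Hg (x, y)).
Qed.

Lemma comput_inl A X Y (f : A -> X) : comput f -> comput (fun x => inl Y (f x)).
Proof.
move=> [r cr Hr]; exists (fun n => pcons (pcons (r n) 0) (pcons 0 0)).
  by apply: cfun_pcons; [apply: cfun_pcons => //|]; apply: cfun_const.
by move=> x; rewrite Hr.
Qed.

Lemma comput_inr A X Y (f : A -> Y) : comput f -> comput (fun x => inr X (f x)).
Proof.
move=> [r cr Hr]; exists (fun n => pcons 0 (pcons (pcons (r n) 0) 0)).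
  apply: cfun_pcons; first exact: cfun_const.
  by apply: cfun_pcons; [apply: cfun_pcons => //|]; apply: cfun_const.
by move=> x; rewrite Hr.
Qed.

Lemma size_leq_pickle X (s : seq X) : size s <= pickle s.
Proof.
elim: s => //= x s IH; rewrite pickle_cons /pcons.
apply: (@leq_trans (pickle s).*2.+1); first by rewrite ltnS; lia.
by rewrite leq_pmull // expn_gt0.
Qed.

(** The state is the remaining list with the accumulator, and it is stationary once the list is
    exhausted; by [size_leq_pickle] the code of the list is a sufficient number of rounds. *)
Lemma comput_foldl A X B (s : A -> seq X) (f : A -> B -> X -> B) (b : A -> B) :
  comput s -> comput (fun z : A * B * X => f z.1.1 z.1.2 z.2) -> comput b ->
  comput (fun x => foldl (f x) (b x) (s x)).
Proof.
move=> cs cf cb.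
pose step x (w : seq X * B) := if w.1 is y :: l then (l, f x w.2 y) else w.
apply: (@comput_ext _ _ (fun x => (iter (pickle (s x)) (step x) (s x, b x)).2)).
  move=> x; have := size_leq_pickle (s x).
  elim: (s x) (pickle (s x)) (b x) => [|y l IH] [|n] c //=.
    by move=> _; rewrite -iterS iterSr; elim: n => //= n; rewrite -iterS iterSr.
  by move=> le; rewrite -iterS iterSr; apply: IH.
apply: comput_snd; apply: comput_iter.
- exact: comput_pickle.
- apply: comput_seq_case; first by apply/comput_fst/comput_snd/comput_id.
    by apply/comput_snd/comput_id.
  apply: comput_pair; first by apply/comput_snd/comput_id.
  have c1 : comput (fun z : A * (seq X * B) * X * seq X => z.1.1)
    by apply/comput_fst/comput_fst/comput_id.
  apply: (comput_app3 cf); first exact: comput_fst.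
    exact/comput_snd/comput_snd.
  by apply/comput_snd/comput_fst/comput_id.
- exact: comput_pair.
Qed.

End Comput.

Ltac cp_step := match goal with
  | H : comput ?f |- comput ?f => exact: H
  | H : comput ?f |- comput (fun x => ?f x) => exact: H
  | |- comput (fun _ => ?c) => exact: comput_const
  | |- comput (fun x => x) => exact: comput_id
  | |- comput (@fst _ _) => exact: (comput_fst (@comput_id _))
  | |- comput (@snd _ _) => exact: (comput_snd (@comput_id _))
  | |- comput (fun x => fst (@?f x)) => apply: comput_fst
  | |- comput (fun x => snd (@?f x)) => apply: comput_snd
  | |- comput (fun x => (@?f x, @?g x)) => apply: comput_pair
  | |- comput (fun x => cons (@?f x) (@?g x)) => apply: comput_cons
  | |- comput (fun x => inl (@?f x)) => apply: comput_inl
  | |- comput (fun x => inr (@?f x)) => apply: comput_inr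
  | |- comput (fun x => andb (@?f x) (@?g x)) => apply: comput_and
  | |- comput (fun x => orb (@?f x) (@?g x)) => apply: comput_or
  | |- comput (fun x => negb (@?f x)) => apply: comput_neg
  | |- comput (fun x => S (@?f x)) => apply: comput_succ
  | |- comput (fun x => leq (@?f x) (@?g x)) => apply: comput_leq
  | |- comput (fun x => eq_op (@?f x) (@?g x)) => apply: comput_eq
  | |- comput (fun x => maxn (@?f x) (@?g x)) => apply: comput_max
  | |- comput (fun x => subn (@?f x) (@?g x)) => apply: comput_sub
  | |- comput (fun x => pickle (@?f x)) => apply: comput_pickle
  end.
Ltac cp := repeat (cbv beta; cp_step).

(** * Computable list operations *)

Section ComputSeq.
Implicit Types A B C X Y : countType.

Lemma comput_rev A X (s : A -> seq X) : comput s -> comput (fun x => rev (s x)).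
Proof.
move=> cs; apply: (@comput_ext _ _ (fun x => foldl (fun acc y => y :: acc) [::] (s x))).
  move=> x; rewrite -[s x in LHS]revK foldl_rev.
  by elim: (rev (s x)) => //= y l ->.
by apply: comput_foldl; cp.
Qed.

Lemma comput_foldr A X B (s : A -> seq X) (f : A -> X -> B -> B) (b : A -> B) :
  comput s -> comput (fun z : A * B * X => f z.1.1 z.2 z.1.2) -> comput b ->
  comput (fun x => foldr (f x) (b x) (s x)).
Proof.
move=> cs cf cb.
apply: (@comput_ext _ _ (fun x => foldl (fun c y => f x y c) (b x) (rev (s x)))).
  by move=> x; rewrite foldl_rev.
apply: comput_foldl => //; exact: comput_rev.
Qed.

Lemma comput_map A X B (s : A -> seq X) (f : A -> X -> B) :
  comput s -> comput (fun z : A * X => f z.1 z.2) ->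
  comput (fun x => [seq f x y | y <- s x]).
Proof.
move=> cs cf.
apply: (@comput_ext _ _ (fun x => foldr (fun y acc => f x y :: acc) [::] (s x))).
  by move=> x; elim: (s x) => //= y l ->.
by apply: comput_foldr; cp; apply: comput_app2; cp.
Qed.

Lemma comput_filter A X (s : A -> seq X) (p : A -> X -> bool) :
  comput s -> comput (fun z : A * X => p z.1 z.2) ->
  comput (fun x => [seq y <- s x | p x y]).
Proof.
move=> cs cf.
apply: (@comput_ext _ _ (fun x =>
    foldr (fun y acc => if p x y then y :: acc else acc) [::] (s x))).
  by move=> x; elim: (s x) => //= y l ->.
by apply: comput_foldr; cp; apply: comput_if; cp; apply: (comput_app2 cf); cp.
Qed.

Lemma comput_cat A X (s t : A -> seq X) :
  comput s -> comput t -> comput (fun x => s x ++ t x).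
Proof.
move=> cs ct.
apply: (@comput_ext _ _ (fun x => foldr cons (t x) (s x))).
  by move=> x; elim: (s x) => //= y l ->.
by apply: comput_foldr; cp.
Qed.

Lemma comput_flatten A X (s : A -> seq (seq X)) :
  comput s -> comput (fun x => flatten (s x)).
Proof. by move=> cs; apply: comput_foldr; cp; apply: comput_cat; cp. Qed.

Lemma comput_size A X (s : A -> seq X) : comput s -> comput (fun x => size (s x)).
Proof.
move=> cs; apply: (@comput_ext _ _ (fun x => foldr (fun _ n => n.+1) 0 (s x))).
  by move=> x; elim: (s x) => //= y l ->.
by apply: comput_foldr; cp.
Qed.

Lemma comput_count A X (s : A -> seq X) (p : A -> X -> bool) :
  comput s -> comput (fun z : A * X => p z.1 z.2) ->
  comput (fun x => count (p x) (s x)).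
Proof.
move=> cs cf; apply: (@comput_ext _ _ (fun x => size [seq y <- s x | p x y])).
  by move=> x; rewrite size_filter.
by apply: comput_size; apply: comput_filter.
Qed.

Lemma comput_all A X (s : A -> seq X) (p : A -> X -> bool) :
  comput s -> comput (fun z : A * X => p z.1 z.2) ->
  comput (fun x => all (p x) (s x)).
Proof.
move=> cs cf.
apply: (@comput_ext _ _ (fun x => foldr (fun y b => p x y && b) true (s x))).
  by move=> x; elim: (s x) => //= y l ->.
by apply: comput_foldr; cp; apply: (comput_app2 cf); cp.
Qed.

Lemma comput_mem A X (y : A -> X) (s : A -> seq X) :
  comput y -> comput s -> comput (fun x => y x \in s x).
Proof.
move=> cy cs.
apply: (@comput_ext _ _ (fun x => foldr (fun z b => (y x == z) || b) false (s x))).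
  by move=> x; elim: (s x) => //= z l ->.
by apply: comput_foldr; cp; apply: (comput_comp cy); cp.
Qed.

Lemma comput_undup A X (s : A -> seq X) : comput s -> comput (fun x => undup (s x)).
Proof.
move=> cs; apply: (@comput_ext _ _ (fun x =>
    foldr (fun y acc => if y \in acc then acc else y :: acc) [::] (s x))).
  move=> x; elim: (s x) => //= y l ->; by rewrite mem_undup.
by apply: comput_foldr; cp; apply: comput_if; cp; apply: comput_mem; cp.
Qed.

Lemma comput_head A X (d : X) (s : A -> seq X) :
  comput s -> comput (fun x => head d (s x)).
Proof. by move=> cs; apply: comput_seq_case; cp. Qed.

Lemma comput_behead A X (s : A -> seq X) :
  comput s -> comput (fun x => behead (s x)).
Proof. by move=> cs; apply: comput_seq_case; cp. Qed.

Lemma comput_nth A X (d : X) (s : A -> seq X) (i : A -> nat) :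
  comput s -> comput i -> comput (fun x => nth d (s x) (i x)).
Proof.
move=> cs ci.
apply: (@comput_ext _ _ (fun x => head d (iter (i x) behead (s x)))).
  move=> x; rewrite -nth0 -[i x in RHS]addn0.
  elim: (i x) (s x) => // n IH [|y l]; rewrite iterSr ?IH ?nth_nil //.
by apply: comput_head; apply: comput_iter; cp; apply: comput_behead; cp.
Qed.

Lemma comput_iota A (n : A -> nat) : comput n -> comput (fun x => iota 0 (n x)).
Proof.
move=> cn; apply: (@comput_ext _ _ (fun x =>
    iter (n x) (fun s => s ++ [:: size s]) [::])).
  by move=> x; elim: (n x) => // m IH; rewrite iterS IH size_iota -addn1 iotaD.
by apply: comput_iter; cp; apply: comput_cat; cp; apply: comput_size; cp.
Qed.

Definition insert_sort (T : Type) (leT : rel T) (s : seq T) : seq T :=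
  foldr (fun x acc =>
    [seq y <- acc | ~~ leT x y] ++ x :: [seq y <- acc | leT x y]) [::] s.

(** Under a total antisymmetric order the sorted arrangement is unique, so [sort] can be replaced by
    an algorithm that is a plain right fold. *)
Lemma sort_insert_sort (T : eqType) (leT : rel T) : total leT -> transitive leT ->
  antisymmetric leT -> sort leT =1 insert_sort leT.
Proof.
move=> tot tr anti s; apply: (sorted_eq tr anti) (sort_sorted tot s) _ _.
  elim: s => //= x s IH; move: IH; rewrite !sorted_pairwise // => IH.
  rewrite pairwise_cat /= !pairwise_filter // !andbT; apply/andP; split.
    apply/allrelP => y z; rewrite mem_filter inE => /andP[nxy _].
    have le_yx : leT y x by have := tot x y; rewrite (negbTE nxy).
    case/predU1P=> [-> //|]; rewrite mem_filter => /andP[xz _].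
    exact: tr le_yx xz.
  by apply/allP => y; rewrite mem_filter => /andP[].
rewrite perm_sort; elim: s => //= x s IH.
rewrite perm_sym -cat1s perm_catCA perm_cons perm_sym.
apply: perm_trans IH _; rewrite perm_sym perm_catC.
exact/permPl/perm_filterC.
Qed.

Lemma comput_sort A X (leT : rel X) (s : A -> seq X) : total leT ->
  transitive leT -> antisymmetric leT -> comput (fun z : X * X => leT z.1 z.2) ->
  comput s -> comput (fun x => sort leT (s x)).
Proof.
move=> tot tr anti cle cs; apply: (@comput_ext _ _ (fun x => insert_sort leT (s x))).
  by move=> x; rewrite sort_insert_sort.
by apply: comput_foldr; cp; apply: comput_cat; [|apply: comput_cons]; cp;
   apply: comput_filter; cp; apply: (comput_app2 cle); cp.
Qed.

Lemma comput_decode A (f : A -> nat) :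
  comput f -> comput (fun x => CodeSeq.decode (f x)).
Proof.
apply: comput_code => x.
rewrite -[LHS](CodeSeq.decodeK (f x)) -[X in CodeSeq.code X = _]map_id //.
Qed.

Lemma comput_chd A (f : A -> nat) : comput f -> comput (fun x => chd (f x)).
Proof. by move=> cf; apply: comput_head; apply: comput_decode. Qed.

Lemma comput_ctl A (f : A -> nat) : comput f -> comput (fun x => ctl (f x)).
Proof.
by apply: comput_comp; exists ctl; first exact: cfun_ctl.
Qed.

End ComputSeq.

(** * Computing with formulae and counter machines *)

Section FormulaComput.
Variables (P : finType) (a : nat).
Local Notation formula := (formula P a).
Local Notation token := (nat + (P + 'I_a * nat))%type.
Implicit Types A B : countType.

(** Pickling a formula pickles this list, so both have the same code. Node [n] opens with
    [inl n.+1], and [inl 0] closes it. *)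
Definition tokens (f : formula) : seq token := GenTree.encode (formula_enc f).

Lemma comput_tokens A (f : A -> formula) :
  comput f -> comput (fun x => tokens (f x)).
Proof. exact: comput_code. Qed.

Lemma comput_of_tokens A (f : A -> formula) :
  comput (fun x => tokens (f x)) -> comput f.
Proof. exact: comput_code. Qed.

Lemma comput_FVar A (p : A -> P) : comput p -> comput (fun x => FVar (p x) : formula).
Proof. by move=> cp; apply: comput_of_tokens; rewrite /tokens /=; cp. Qed.

Lemma comput_FNeg A (f : A -> formula) : comput f -> comput (fun x => FNeg (f x)).
Proof.
move=> cf; apply: comput_of_tokens.
apply: (@comput_ext _ _ (fun x => inl 2 :: (tokens (f x) ++ [:: inl 0]))).
  by move=> x; rewrite /tokens /= cats0 cats1.
by cp; apply: comput_cat; cp; apply: comput_tokens.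
Qed.

Lemma comput_FAnd A (f g : A -> formula) :
  comput f -> comput g -> comput (fun x => FAnd (f x) (g x)).
Proof.
move=> cf cg; apply: comput_of_tokens.
apply: (@comput_ext _ _ (fun x =>
    inl 3 :: (tokens (f x) ++ (tokens (g x) ++ [:: inl 0])))).
  by move=> x; rewrite /tokens /= cats0 -cats1 catA.
by cp; do 2!(apply: comput_cat; [exact: comput_tokens|]); cp.
Qed.

Lemma comput_FDia A (al : A -> 'I_a) (k : A -> nat) (f : A -> formula) :
  comput al -> comput k -> comput f -> comput (fun x => FDia (al x) (k x) (f x)).
Proof.
move=> cal ck cf; apply: comput_of_tokens.
apply: (@comput_ext _ _ (fun x =>
    inl 4 :: inr (inr (al x, k x)) :: (tokens (f x) ++ [:: inl 0]))).
  by move=> x; rewrite /tokens /= cats0 -cats1.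
by cp; apply: comput_cat; [exact: comput_tokens|cp].
Qed.

Lemma comput_FDiaEq A (al : A -> 'I_a) (k : A -> nat) (f : A -> formula) :
  comput al -> comput k -> comput f -> comput (fun x => FDiaEq (al x) (k x) (f x)).
Proof.
move=> cal ck cf; apply: comput_FAnd; first exact: comput_FDia.
by apply/comput_FNeg/comput_FDia => //; apply: comput_succ.
Qed.

Fixpoint formula_fold B (top : B) (var : P -> B) (neg : B -> B)
    (conj : B -> B -> B) (dia : 'I_a -> nat -> B -> B) (f : formula) : B :=
  let fold := formula_fold top var neg conj dia in
  match f with
  | FTop => top
  | FVar p => var p
  | FNeg g => neg (fold g)
  | FAnd g h => conj (fold g) (fold h)
  | FDia al k g => dia al k (fold g)
  end.

(* One right-to-left step of the evaluation of a formula from its prefix-order *)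
(* tokens; closing brackets and the node token of a diamond are skipped.       *)
Definition fold_step B (top : B) (var : P -> B) (neg : B -> B)
    (conj : B -> B -> B) (dia : 'I_a -> nat -> B -> B)
    (t : token) (stk : seq B) : seq B :=
  match t with
  | inl n =>
      if n == 1 then top :: stk
      else if n == 2 then if stk is b :: r then neg b :: r else stk
      else if n == 3 then
        if stk is b :: r then if r is c :: r' then conj b c :: r' else stk else stk
      else stk
  | inr l =>
      match l with
      | inl p => var p :: stk
      | inr u => if stk is b :: r then dia u.1 u.2 b :: r else stk
      end
  end.

Lemma foldr_tokens B top var neg conj dia (f : formula) (stk : seq B) :
  foldr (fold_step top var neg conj dia) stk (tokens f) =
  formula_fold top var neg conj dia f :: stk.
Proof.
rewrite /tokens; elim: f stk => //= [g IH|g IHg h IHh|al k g IH] stk.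
- by rewrite cats0 foldr_rcons /= IH.
- by rewrite cats0 foldr_rcons foldr_cat /= IHh IHg.
- by rewrite cats0 foldr_rcons /= IH.
Qed.

Lemma comput_formula_fold A B (top : A -> B) (var : A -> P -> B)
    (neg : A -> B -> B) (conj : A -> B -> B -> B)
    (dia : A -> 'I_a -> nat -> B -> B) (f : A -> formula) :
  comput top -> comput (fun z : A * P => var z.1 z.2) ->
  comput (fun z : A * B => neg z.1 z.2) ->
  comput (fun z : A * B * B => conj z.1.1 z.1.2 z.2) ->
  comput (fun z : A * ('I_a * nat) * B => dia z.1.1 z.1.2.1 z.1.2.2 z.2) ->
  comput f ->
  comput (fun x => formula_fold (top x) (var x) (neg x) (conj x) (dia x) (f x)).
Proof.
move=> ctop cvar cneg cconj cdia cf.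
apply: (@comput_ext _ _ (fun x => head (top x)
  (foldr (fold_step (top x) (var x) (neg x) (conj x) (dia x)) [::] (tokens (f x))))).
  by move=> x; rewrite foldr_tokens.
apply: comput_seq_case; cp.
apply: comput_foldr; cp; first exact: comput_tokens.
apply: comput_sum_case; cp.
- apply: comput_if; cp; first by apply: (comput_comp ctop); cp.
  apply: comput_if; cp.
    apply: comput_seq_case; cp.
    by apply: (comput_app2 cneg); cp.
  apply: comput_if; cp.
  apply: comput_seq_case; cp.
  apply: comput_seq_case; cp.
  by apply: (comput_app3 cconj); cp.
- apply: comput_sum_case; cp.
    by apply: (comput_app2 cvar); cp.
  apply: comput_seq_case; cp.
  apply: (@comput_app3 _ _ _ _ _ (fun x (u : 'I_a * nat) y => dia x u.1 u.2 y)); cp.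
Qed.

End FormulaComput.

(** * Computable simulation of counter machines *)

Section Simulation.

(** Register contents of type [nat -> nat] have no codes; a finite list, padded by zeros on reading,
    replaces them. *)
Definition sim_instr (i : cm_instr) (s : nat * seq nat) : nat * seq nat :=
  match i with
  | CM_INC r j => (j, set_nth 0 s.2 r (nth 0 s.2 r).+1)
  | CM_DEC r j k =>
      if nth 0 s.2 r is m.+1 then (j, set_nth 0 s.2 r m) else (k, s.2)
  end.

Definition sim_step p (s : nat * seq nat) : nat * seq nat :=
  nth id (map sim_instr p) s.1 s.

Lemma cm_step_sim p s :
  cm_step p (s.1, nth 0 s.2) = ((sim_step p s).1, nth 0 (sim_step p s).2).
Proof.
case: s => pc l; rewrite /sim_step /=.
have [ltp|lep] := ltnP pc (size p); last first.
  by rewrite !nth_default ?size_map.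
rewrite (nth_map (CM_INC 0 0)) // (nth_map (CM_INC 0 0)) //.
case: (nth _ p pc) => [r j|r j k] /=.
  congr pair; apply: functional_extensionality => x.
  by rewrite nth_set_nth /=; case: eqP => // ->.
case: (nth 0 l r) => //= m; congr pair; apply: functional_extensionality => x.
by rewrite nth_set_nth.
Qed.

Lemma cm_run_sim p n t : let s := iter t (sim_step p) (0, [:: 0; n]) in
  cm_run p n t = (s.1, nth 0 s.2).
Proof.
elim: t => [|t IH] /=; last by rewrite -cm_step_sim -IH.
rewrite /cm_run /=; congr pair; apply: functional_extensionality => -[|[|x]] //.
by rewrite /= nth_nil.
Qed.

Lemma comput_set_nth (A : countType) r (s : A -> seq nat) (v : A -> nat) :
  comput s -> comput v -> comput (fun x => set_nth 0 (s x) r (v x)).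
Proof.
move=> cs cv; elim: r s cs => [|r IH] s cs.
  apply: (@comput_ext _ _ (fun x => v x :: behead (s x))).
    by move=> x; case: (s x).
  by cp; apply: comput_behead.
apply: (@comput_ext _ _ (fun x => head 0 (s x) :: set_nth 0 (behead (s x)) r (v x))).
  by move=> x; case: (s x) => //=; rewrite set_nth_nil; case: r {IH}.
cp; first exact: comput_head.
by apply: IH; apply: comput_behead.
Qed.

Lemma comput_sim_instr i : comput (sim_instr i).
Proof.
case: i => [r j|r j k]; rewrite /sim_instr.
  apply: (comput_pair (comput_const _ j)); apply: comput_set_nth; cp.
  by apply: comput_nth; cp.
apply: comput_nat_case; cp; first by apply: comput_nth; cp.
by apply: comput_set_nth; cp.
Qed.

(** The program is fixed, so fetching an instruction is a nested case distinction over it and no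
    coding of instructions is involved. *)
Lemma comput_sim_step (A : countType) p (s : A -> nat * seq nat) :
  comput s -> comput (fun x => sim_step p (s x)).
Proof.
move=> cs; apply: (comput_app2 (h := fun pc s => nth id (map sim_instr p) pc s)); cp.
elim: p => [|i p IH] /=.
  by apply: (comput_ext _ (comput_snd (@comput_id _))) => x; rewrite nth_nil.
apply: (@comput_ext _ _ (fun z => if z.1 is m.+1
    then nth id [seq sim_instr j | j <- p] m z.2 else sim_instr i z.2)).
  by case=> [[|pc]].
apply: comput_nat_case; cp.
  by apply: (comput_comp (comput_sim_instr i)); cp.
by apply: (comput_app2 IH); cp.
Qed.

Lemma comput_halts (A : countType) p (n t : A -> nat) :
  comput n -> comput t -> comput (fun x => cm_halts p (n x) (t x)).
Proof.
move=> cn ct.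
apply: (@comput_ext _ _ (fun x =>
    size p <= (iter (t x) (sim_step p) (0, [:: 0; n x])).1)).
  by move=> x; rewrite /cm_halts cm_run_sim.
by cp; apply: comput_iter; cp; apply: comput_sim_step; cp.
Qed.

End Simulation.

(** * Full types characterize models up to a modal depth *)

Section Types.
Variables (P : finType) (a : nat).
Local Notation formula := (formula P a).

Lemma le_formula_total : total (@le_formula P a).
Proof. by move=> f g; apply: leq_total. Qed.

Lemma le_formula_trans : transitive (@le_formula P a).
Proof. by move=> g f h; apply: leq_trans. Qed.

Lemma le_formula_anti : antisymmetric (@le_formula P a).
Proof. by move=> f g; rewrite /le_formula -eqn_leq => /eqP/(pcan_inj pickleK). Qed.

Lemma mem_canon (s : seq formula) : canon s =i s.
Proof. by move=> f; rewrite mem_sort mem_undup. Qed.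

(** [le_formula] orders formulae totally by their codes, so the sorted duplicate-free list depends
    only on the set of its members. *)
Lemma eq_canon (s1 s2 : seq formula) : s1 =i s2 -> canon s1 = canon s2.
Proof.
move=> E; apply/perm_sortP.
- exact: le_formula_total.
- exact: le_formula_trans.
- exact: le_formula_anti.
by apply: uniq_perm; rewrite ?undup_uniq // => f; rewrite !mem_undup E.
Qed.

(** The common shape of full types of positive depth and of transition values: all counts are
    exact. *)
Definition node_conjuncts (ls : 'I_a -> seq formula) : seq formula :=
  [seq FDiaEq al (count_mem s (ls al)) s | al <- enum 'I_a, s <- undup (ls al)]
  ++ [seq FDiaEq al (size (ls al)) FTop | al <- enum 'I_a].

Definition node_type (t0 : formula) (ls : 'I_a -> seq formula) : formula :=
  conjL (t0 :: canon (node_conjuncts ls)).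

Lemma node_conjunctsP (ls : 'I_a -> seq formula) f :
  reflect ((exists al s, s \in ls al /\ f = FDiaEq al (count_mem s (ls al)) s) \/
           (exists al, f = FDiaEq al (size (ls al)) FTop))
          (f \in node_conjuncts ls).
Proof.
rewrite mem_cat; apply: (iffP orP) => -[].
- case/allpairsPdep => al [s] [_ si ->]; left; exists al, s.
  by rewrite mem_undup in si.
- by case/mapP=> al _ ->; right; exists al.
- case=> al [s] [si ->]; left; apply/allpairsPdep; exists al, s.
  by rewrite mem_enum mem_undup.
- by case=> al ->; right; apply/mapP; exists al; rewrite ?mem_enum.
Qed.

Lemma perm_node_type t0 (ls1 ls2 : 'I_a -> seq formula) :
  (forall al, perm_eq (ls1 al) (ls2 al)) -> node_type t0 ls1 = node_type t0 ls2.
Proof.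
move=> E; congr (conjL (_ :: _)); apply: eq_canon => f.
have Ec al s : count_mem s (ls1 al) = count_mem s (ls2 al) by apply/permP.
have Es al : size (ls1 al) = size (ls2 al) by apply: perm_size.
apply/node_conjunctsP/node_conjunctsP => -[] [al].
- case=> s [si ->]; left; exists al, s; rewrite Ec; split=> //.
  by rewrite -(perm_mem (E al)).
- by move=> ->; right; exists al; rewrite Es.
- case=> s [si ->]; left; exists al, s; rewrite Ec; split=> //.
  by rewrite (perm_mem (E al)).
- by move=> ->; right; exists al; rewrite Es.
Qed.

Section Model.
Variables (W : finType) (M : model P a W).

(** Full types with the widths eliminated, which allows induction on the depth. *)
Fixpoint ftype n (w : W) : formula :=
  if n is m.+1
  then node_type (type_eps M w) (fun al => [seq ftype m v | v <- enum (nbhd M al w)])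
  else type_eps M w.

Lemma reach_step al w v u i :
  mrel M al w v -> u \in reach M i v -> u \in reach M i.+1 w.
Proof.
move=> wv; elim: i u => [|i IH] u.
  rewrite !inE => /eqP->; apply/existsP; exists w; rewrite inE eqxx /=.
  by apply/existsP; exists al.
rewrite [reach _ i.+1 v]/= inE => /existsP[x /andP[xr xu]].
rewrite [reach _ _ _]/= inE; apply/existsP; exists x; apply/andP; split=> //.
exact: IH.
Qed.

(** A width above the number of successors exceeds every count of a successor type, so no
    lower-bound conjunct appears and every total count does. *)
Lemma type_w_ftype (ks : seq ('I_a -> nat)) w :
  (forall i v al, i < size ks -> v \in reach M i w ->
     #|nbhd M al v| < nth (fun=> 0) ks i al) ->
  type_w M ks w = ftype (size ks) w.
Proof.
elim: ks w => [//|k0 ks IH] w H.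
rewrite [LHS]/= [RHS]/= /node_type /node_conjuncts.
have Hk al : #|nbhd M al w| < k0 al by apply: (H 0); rewrite // inE.
have Es al : [seq type_w M ks v | v <- enum (nbhd M al w)] =
             [seq ftype (size ks) v | v <- enum (nbhd M al w)].
  apply/eq_in_map => v; rewrite mem_enum inE => wv; apply: IH => i u be lti ur.
  by apply: (H i.+1) => //; apply: reach_step ur; exact: wv.
congr (conjL (_ :: canon (_ ++ _))).
  congr flatten; apply/eq_map => al; rewrite Es.
  apply/eq_map => s /=; case: ifP => // /negbT; rewrite -leqNgt => le.
  have := leq_trans le (count_size _ _); rewrite size_map -cardE leqNgt.
  by rewrite Hk.
have -> : [seq al <- enum 'I_a | #|nbhd M al w| < k0 al] = enum 'I_a.
  by apply/all_filterP/allP => al _; apply: Hk.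
by apply/eq_map => al; rewrite size_map -cardE.
Qed.

Lemma full_type_ftype n w : full_type M n w = ftype n w.
Proof.
rewrite /full_type type_w_ftype size_mkseq // => i v al lti vr.
rewrite nth_mkseq // ltnS.
exact: (@leq_bigmax_cond _ (mem (reach M i w)) (fun v => #|nbhd M al v|)).
Qed.

Lemma sat_conjL w (s : seq formula) : sat M w (conjL s) = all (sat M w) s.
Proof.
elim: s => [//|f s IH]; case: s IH => [|g s] IH; first by rewrite /= andbT.
exact: (congr1 (andb (sat M w f)) IH).
Qed.

Lemma sat_FDiaEq w al k f :
  sat M w (FDiaEq al k f) = (#|[set v | mrel M al w v & sat M v f]| == k).
Proof. by rewrite /= -leqNgt eqn_leq andbC. Qed.

Lemma sat_type_eps_set w (S : {set P}) :
  sat M w (type_eps_set a S) = (props_at M w == S).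
Proof.
rewrite /type_eps_set sat_conjL all_map.
apply/allP/eqP => [H|<- p _ /=].
  apply/setP => p; have := H p; rewrite mem_enum inE => /(_ isT) /=.
  rewrite inE; case: (p \in S) => //= nv; exact: negbTE.
by rewrite inE; case: ifP => /= [|->].
Qed.

Lemma sat_node_type w t0 (ls : 'I_a -> seq formula) :
  sat M w (node_type t0 ls) <->
  [/\ sat M w t0,
      forall al s, s \in ls al ->
        #|[set v | mrel M al w v & sat M v s]| = count_mem s (ls al)
    & forall al, #|nbhd M al w| = size (ls al)].
Proof.
rewrite /node_type sat_conjL [all _ _]/= (eq_all_r (mem_canon _)).
have Et al : [set v | mrel M al w v & sat M v FTop] = nbhd M al w.
  by apply/setP => v; rewrite !inE andbT.
split=> [/andP[-> /allP H]|[-> H1 H2] /=].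
  split=> // [al s si|al].
    by apply/eqP; rewrite -sat_FDiaEq; apply/H/node_conjunctsP; left; exists al, s.
  by apply/eqP; rewrite -Et -sat_FDiaEq; apply/H/node_conjunctsP; right; exists al.
apply/allP => f /node_conjunctsP[[al] [s] [si ->]|[al ->]]; rewrite sat_FDiaEq.
  exact/eqP/H1.
by rewrite Et H2.
Qed.

Lemma count_enum (A : {set W}) (p : pred W) :
  count p (enum A) = #|[set v in A | p v]|.
Proof.
rewrite -size_filter.
have <- : #|[seq v <- enum A | p v]| = size [seq v <- enum A | p v].
  by apply/card_uniqP; rewrite filter_uniq ?enum_uniq.
by apply: eq_card => v; rewrite !inE mem_filter mem_enum andbC.
Qed.

Lemma card_sat_count w al f :
  #|[set v | mrel M al w v & sat M v f]| =
  count (fun v => sat M v f) (enum (nbhd M al w)).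
Proof. by rewrite count_enum; apply: eq_card => v; rewrite !inE. Qed.

End Model.

(** The members of [s] that lie in [t] already form a permutation of [t], and equal sizes leave room
    for no others. In a type, the conjunct counting all successors supplies the equality of
    sizes. *)
Lemma perm_eq_counts (T : eqType) (s t : seq T) : size s = size t ->
  {in t, forall x, count_mem x s = count_mem x t} -> perm_eq s t.
Proof.
move=> Es Ec; have pf : perm_eq [seq x <- s | x \in t] t.
  apply/allP => x _ /=; apply/eqP; rewrite count_filter.
  have [xt|xt] := boolP (x \in t).
    rewrite -Ec //; apply: eq_count => y /=; case: eqP => // ->; exact: xt.
  rewrite (count_memPn xt); apply/eqP; rewrite -leqn0 leqNgt -has_count.
  by apply/hasPn => y _ /=; case: eqP => // ->.
suff <- : [seq x <- s | x \in t] = s by [].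
by apply/all_filterP; rewrite all_count -size_filter Es (perm_size pf).
Qed.

(** By induction, the successors satisfying a type are those having it, so the diamonds of the type
    fix the multiset of successor types, and a type is determined by its atoms and that multiset. *)
Lemma ftype_sat n (W W' : finType) (M : model P a W) (M' : model P a W') w w' :
  sat M' w' (ftype M n w) <-> ftype M' n w' = ftype M n w.
Proof.
elim: n W W' M M' w w' => [|n IH] W W' M M' w w'.
  rewrite /= /type_eps sat_type_eps_set; split=> [/eqP-> //|E].
  have : sat M' w' (type_eps_set a (props_at M' w')) by rewrite sat_type_eps_set.
  by rewrite E sat_type_eps_set.
have cnt W1 W2 (M1 : model P a W1) (M2 : model P a W2) w1 u2 al :
    #|[set v | mrel M1 al w1 v & sat M1 v (ftype M2 n u2)]| =
    count_mem (ftype M2 n u2) [seq ftype M1 n v | v <- enum (nbhd M1 al w1)].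
  rewrite card_sat_count count_map; apply: eq_count => v /=.
  by apply/idP/eqP => /IH.
have self W1 (M1 : model P a W1) w1 : sat M1 w1 (ftype M1 n.+1 w1).
  apply/sat_node_type; split=> [|al s /mapP[v _ ->]|al].
  - by rewrite /type_eps sat_type_eps_set.
  - exact: cnt.
  - by rewrite size_map -cardE.
split=> [/sat_node_type[s0 s1 s2]|<-]; last exact: self.
move: s0; rewrite /type_eps sat_type_eps_set => /eqP Ep.
rewrite [LHS]/= [RHS]/= /type_eps Ep; apply: perm_node_type => al.
apply: perm_eq_counts; first by rewrite size_map -cardE s2.
by move=> s si; rewrite -s1 //; case/mapP: si => v _ ->; rewrite cnt.
Qed.

(** * Agreement on formulae of bounded modal depth *)

Fixpoint depth (f : formula) : nat :=
  match f with
  | FTop | FVar _ => 0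
  | FNeg g => depth g
  | FAnd g h => maxn (depth g) (depth h)
  | FDia _ _ g => (depth g).+1
  end.

(** Equality of types is inverted semantically, through satisfaction, instead of taking apart sorted
    conjunctions. *)
Lemma ftype_succ_perm n (W W' : finType) (M : model P a W) (M' : model P a W') w w' :
  ftype M' n.+1 w' = ftype M n.+1 w ->
  props_at M' w' = props_at M w /\
  forall al, perm_eq [seq ftype M' n v | v <- enum (nbhd M' al w')]
                     [seq ftype M n v | v <- enum (nbhd M al w)].
Proof.
move/(iffRL (ftype_sat _ _ _ _ _))/sat_node_type=> [].
rewrite /type_eps sat_type_eps_set => /eqP Ep s1 s2; split=> // al.
apply: perm_eq_counts; first by rewrite size_map -cardE s2.
move=> s si; rewrite -s1 //; case/mapP: si => v _ ->.
rewrite card_sat_count count_map; apply: eq_count => u /=.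
by apply/eqP/idP => /ftype_sat.
Qed.

Lemma ftype_props n (W W' : finType) (M : model P a W) (M' : model P a W') w w' :
  ftype M' n w' = ftype M n w -> props_at M' w' = props_at M w.
Proof.
case: n => [|n /ftype_succ_perm[]//].
move/(iffRL (ftype_sat 0 _ _ _ _)).
by rewrite /= /type_eps sat_type_eps_set => /eqP.
Qed.

(** For a diamond, the truth of its body at a successor depends only on the type of that successor
    one level lower, and these types form the same multiset on both sides. *)
Lemma sat_ftype_eq f n (W W' : finType) (M : model P a W) (M' : model P a W') w w' :
  depth f <= n -> ftype M' n w' = ftype M n w -> sat M' w' f = sat M w f.
Proof.
elim: f n W W' M M' w w' => [|p|g IH|g IHg h IHh|al k g IH] n W W' M M' w w' //=.
- by move=> _ /ftype_props/setP/(_ p); rewrite !inE.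
- by move=> le E; rewrite (IH _ _ _ _ _ _ _ le E).
- rewrite geq_max => /andP[leg leh] E.
  by rewrite (IHg _ _ _ _ _ _ _ leg E) (IHh _ _ _ _ _ _ _ leh E).
case: n => // n; rewrite ltnS => le /ftype_succ_perm[_ /(_ al) E].
rewrite !card_sat_count; congr (k <= _).
(* The truth of [g] read off from a type [s]; by the induction hypothesis it does not matter which
   successor realizes [s]. Both counts become counts of [q] over permuted lists. *)
pose q s := [exists v, [&& v \in nbhd M al w, ftype M n v == s & sat M v g]].
have Eq W1 (M1 : model P a W1) (u : W1) v : v \in nbhd M al w ->
    ftype M1 n u = ftype M n v -> sat M1 u g = q (ftype M1 n u).
  move=> vN Eu; apply/idP/existsP => [su|[v' /and3P[_ /eqP Ev sv]]].
    exists v; rewrite vN Eu eqxx /=.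
    by rewrite -(IH _ _ _ _ _ _ _ le Eu).
  by rewrite (IH _ _ _ _ _ _ _ le (esym Ev)).
rewrite (_ : count _ (enum (nbhd M' al w')) =
             count q [seq ftype M' n v | v <- enum (nbhd M' al w')]).
  rewrite (permP E) count_map; apply: eq_in_count => v.
  by rewrite mem_enum => vN; rewrite /= -(Eq _ _ _ v).
rewrite count_map; apply: eq_in_count => u uN /=.
have : ftype M' n u \in [seq ftype M n v | v <- enum (nbhd M al w)].
  by rewrite -(perm_mem E) map_f.
by case/mapP => v; rewrite mem_enum => vN Eu; apply: Eq vN Eu.
Qed.

End Types.

(** * Types of nodes with prescribed successor types *)

Section Automaton.
Variables (P : finType) (a : nat).
Hypothesis a_gt0 : 0 < a.
Local Notation formula := (formula P a).
Local Notation fullT := (fullT P a).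

(* [height] follows only the diamonds that force a successor, so on the type *)
(* of depth [n] of [w] it is the length of a longest path from [w], cut at    *)
(* [n]; [mdepth] exceeds it exactly when no path of length [n] starts at [w]. *)
Fixpoint height (f : formula) : nat :=
  match f with
  | FAnd g h => maxn (height g) (height h)
  | FDia _ k g => if k is 0 then 0 else (height g).+1
  | _ => 0
  end.

Fixpoint mdepth (f : formula) : nat :=
  match f with
  | FAnd g h => maxn (mdepth g) (mdepth h)
  | FDia _ _ g => (mdepth g).+1
  | _ => 0
  end.

Lemma height_conjL (s : seq formula) k :
  (height (conjL s) <= k) = all (fun f => height f <= k) s.
Proof.
elim: s => [//|f s IH]; case: s IH => [|g s] IH; first by rewrite /= andbT.
rewrite -[conjL _]/(FAnd f (conjL (g :: s))) [height _]/= geq_max IH //.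
Qed.

Lemma mdepth_conjL (s : seq formula) k :
  (mdepth (conjL s) <= k) = all (fun f => mdepth f <= k) s.
Proof.
elim: s => [//|f s IH]; case: s IH => [|g s] IH; first by rewrite /= andbT.
rewrite -[conjL _]/(FAnd f (conjL (g :: s))) [mdepth _]/= geq_max IH //.
Qed.

Lemma height_type_eps_set (S : {set P}) : height (type_eps_set a S) = 0.
Proof.
apply/eqP; rewrite -leqn0 height_conjL all_map.
by apply/allP => p _ /=; case: ifP.
Qed.

Lemma mdepth_type_eps_set (S : {set P}) : mdepth (type_eps_set a S) = 0.
Proof.
apply/eqP; rewrite -leqn0 mdepth_conjL all_map.
by apply/allP => p _ /=; case: ifP.
Qed.

(** A type that occurs is counted positively, while a total count of 0 is ignored by [height]; only
    actual edges contribute. *)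
Lemma height_ftypeS (W : finType) (M : model P a W) n w k :
  height (ftype M n.+1 w) <= k <->
  forall al v, mrel M al w v -> height (ftype M n v) < k.
Proof.
rewrite [ftype _ _ _]/= /node_type height_conjL [all _ _]/=.
rewrite /type_eps height_type_eps_set leq0n (eq_all_r (mem_canon _)).
split=> [/allP H al v wv|H].
  set ls := fun al : 'I_a => _ in H.
  have vi : ftype M n v \in ls al by apply: map_f; rewrite mem_enum inE.
  have mem : FDiaEq al (count_mem (ftype M n v) (ls al)) (ftype M n v)
      \in node_conjuncts ls.
    by apply/node_conjunctsP; left; exists al, (ftype M n v).
  have := H _ mem; rewrite /= maxn0.
  have : 0 < count_mem (ftype M n v) (ls al) by rewrite -has_count has_pred1.
  by case: (count_mem _ _).
apply/allP => f /node_conjunctsP[[al] [s] [si ->]|[al ->]] /=.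
  rewrite maxn0; case: (count_mem _ _) => // _.
  by case/mapP: si => v; rewrite mem_enum inE => wv ->; apply: H wv.
rewrite maxn0 size_map -cardE.
case: (pickP (mem (nbhd M al w))) => [v|/eq_card0->//] vi.
case: #|_| => // _; rewrite inE /= inE in vi.
by apply: leq_ltn_trans (H al v vi).
Qed.

(** In contrast to [height], a total count of 0 is a diamond too, and [a_gt0] provides such a
    conjunct at every node; whence [0 < k]. *)
Lemma mdepth_ftypeS (W : finType) (M : model P a W) n w k :
  mdepth (ftype M n.+1 w) <= k <->
  0 < k /\ forall al v, mrel M al w v -> mdepth (ftype M n v) < k.
Proof.
rewrite [ftype _ _ _]/= /node_type mdepth_conjL [all _ _]/=.
rewrite /type_eps mdepth_type_eps_set leq0n (eq_all_r (mem_canon _)).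
set ls := fun al : 'I_a => _.
split=> [/allP H|[k0 H]].
  split=> [|al v wv].
    have /H : FDiaEq (Ordinal a_gt0) (size (ls (Ordinal a_gt0))) FTop \in node_conjuncts ls.
      by apply/node_conjunctsP; right; exists (Ordinal a_gt0).
    by rewrite /= maxn0.
  have vi : ftype M n v \in ls al by apply: map_f; rewrite mem_enum inE.
  have := H (FDiaEq al (count_mem (ftype M n v) (ls al)) (ftype M n v)).
  rewrite /= maxn0; apply; apply/node_conjunctsP; left.
  by exists al, (ftype M n v).
apply/allP => f /node_conjunctsP[[al] [s] [si ->]|[al ->]] /=; rewrite maxn0 //.
by case/mapP: si => v; rewrite mem_enum inE => wv ->; apply: H wv.
Qed.

Lemma height_ftype_le (W : finType) (M : model P a W) n w :
  height (ftype M n w) <= n.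
Proof.
elim: n w => [|n IH] w; first by rewrite [ftype _ _ _]/= height_type_eps_set.
by apply/height_ftypeS => al v _; rewrite ltnS.
Qed.

(** If the longest path is shorter than [n], its dead end still carries a diamond counting 0
    successors, which adds one to the height; a path of length [n] is cut before that. *)
Lemma mdepth_ftype (W : finType) (M : model P a W) n w :
  mdepth (ftype M n w) =
  if height (ftype M n w) == n then n else (height (ftype M n w)).+1.
Proof.
elim: n w => [|n IH] w.
  by rewrite [ftype _ _ _]/= height_type_eps_set mdepth_type_eps_set.
have le v : mdepth (ftype M n v) <= n.
  by rewrite IH; have := height_ftype_le M n v; case: eqP; lia.
set p := height (ftype M n.+1 w).
have lep : p <= n.+1 := height_ftype_le M n.+1 w.
have hp := iffLR (height_ftypeS M n w p) (leqnn p).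
apply/eqP; rewrite eqn_leq; apply/andP; split.
  apply/mdepth_ftypeS; case: eqP => ne; split=> // al v wv; have := hp al v wv.
    by have := le v; lia.
  by rewrite IH; case: eqP; lia.
rewrite leqNgt; apply/negP; case: eqP => ne.
  rewrite ltnS => /mdepth_ftypeS[_ H].
  suff : p <= n by lia.
  apply/height_ftypeS => al v wv; have := H al v wv; rewrite IH.
  by have := hp al v wv; case: eqP; lia.
rewrite ltnS => /mdepth_ftypeS[p0 H].
suff : p <= p.-1 by lia.
apply/height_ftypeS => al v wv; have := H al v wv; rewrite IH.
by have := hp al v wv; case: eqP; lia.
Qed.

(** When all paths end before the cut, deepening the type changes nothing, so one formula is the
    type at every depth above its height. *)
Lemma ftype_stable (W : finType) (M : model P a W) n m w :
  height (ftype M n w) < n -> height (ftype M n w) < m ->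
  ftype M m w = ftype M n w.
Proof.
elim: n m w => // n IH [//|m] w; rewrite !ltnS => /height_ftypeS Hn /height_ftypeS Hm.
rewrite [LHS]/= [RHS]/=; apply: perm_node_type => al.
suff -> : [seq ftype M m v | v <- enum (nbhd M al w)] =
          [seq ftype M n v | v <- enum (nbhd M al w)] by [].
apply/eq_in_map => v; rewrite mem_enum inE => wv.
by apply: IH; [apply: Hn wv|apply: Hm wv].
Qed.

Lemma is_full_typeP n (tau : formula) : is_full_type n tau <->
  exists (W : finType) (M : model P a W) (w : W), ftype M n w = tau.
Proof.
by split=> -[W [M [w <-]]]; exists W, M, w; rewrite full_type_ftype.
Qed.

(** Each type either has the largest [mdepth] or describes a node without full-length paths, and is
    then a type of all larger depths as well. *)
Definition consistent (s : seq formula) : bool :=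
  let m := foldr maxn 0 (map mdepth s) in
  all (fun f => (mdepth f == m) || (height f < mdepth f)) s.

Lemma foldr_maxn_ge (s : seq nat) k : (foldr maxn 0 s <= k) = all (leq^~ k) s.
Proof. by elim: s => //= x s IH; rewrite geq_max IH. Qed.

Lemma consistentP (s : seq formula) : (forall f, f \in s -> is_full f) ->
  consistent s <-> exists n, forall f, f \in s -> is_full_type n f.
Proof.
move=> full; set m := foldr maxn 0 (map mdepth s).
have lem f : f \in s -> mdepth f <= m.
  move=> fs; have := leqnn m; rewrite {1}/m foldr_maxn_ge => /allP; apply.
  exact: map_f.
split=> [/allP H|[n Hn]].
  (* The largest [mdepth] is the common depth. A type whose height equals its depth has that depth
     as its [mdepth], which must be [m]; any other has height below [m] and is stable. *)
  exists m => f fs; have [n /is_full_typeP[W [M [w E]]]] := full f fs.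
  apply/is_full_typeP; exists W, M, w; have := H f fs; rewrite -/m.
  have := lem f fs; have := mdepth_ftype M n w; have := height_ftype_le M n w.
  rewrite E; case: (eqVneq (height f) n) => [-> _ ->|ne le -> le'].
    by rewrite ltnn orbF => _ /eqP <-.
  by move=> _; rewrite -E; apply: ftype_stable; rewrite E //; lia.
apply/allP => f fs; rewrite -/m.
have ley g : g \in s -> mdepth g <= n.
  move=> /Hn/is_full_typeP[W [M [w <-]]]; rewrite mdepth_ftype.
  by have := height_ftype_le M n w; case: eqP; lia.
have lemn : m <= n.
  by rewrite /m foldr_maxn_ge all_map; apply/allP => g /ley.
have := lem f fs; have /is_full_typeP[W [M [w <-]]] := Hn f fs.
rewrite mdepth_ftype; case: eqP => [->|_]; last by rewrite ltnSn orbT.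
by move=> le; apply/orP; left; rewrite eqn_leq le.
Qed.

Lemma modal_free_conjL (s : seq formula) :
  modal_free (conjL s) = all (@modal_free P a) s.
Proof.
elim: s => [//|f s IH]; case: s IH => [|g s] IH; first by rewrite /= andbT.
exact: (congr1 (andb (modal_free f)) IH).
Qed.

(** A type of depth 0 may itself be a conjunction, hence the test for modal freeness. At positive
    depth a modal conjunct always exists because [0 < a], so the left conjunct is the atomic
    part. *)
Lemma type0_of_ftype (W : finType) (M : model P a W) n w :
  type0_of (ftype M n w) = type_eps M w.
Proof.
case: n => [|n].
  rewrite /type0_of /= modal_free_conjL all_map.
  by case: ifP => // /negP[]; apply/allP => p _ /=; case: ifP.
rewrite [ftype _ _ _]/= /node_type; set ls := fun al : 'I_a => _.
have mem : FDiaEq (Ordinal a_gt0) (size (ls (Ordinal a_gt0))) FTop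
    \in canon (node_conjuncts ls).
  by rewrite mem_canon; apply/node_conjunctsP; right; exists (Ordinal a_gt0).
rewrite /type0_of modal_free_conjL [all _ _]/=.
rewrite (introF allP) ?andbF; last by move=> h; have := h _ mem.
by case: (canon _) mem.
Qed.

(** * Realizing prescribed successor types *)

Lemma enum_imset_inj (T1 T2 : finType) (h : T1 -> T2) (A : {set T1}) :
  injective h -> perm_eq (enum (h @: A)) [seq h x | x <- enum A].
Proof.
move=> inj; apply: uniq_perm; rewrite ?enum_uniq ?map_inj_uniq ?enum_uniq // => y.
rewrite mem_enum; apply/imsetP/mapP => -[x xA ->]; exists x => //.
  by rewrite mem_enum.
by rewrite mem_enum in xA.
Qed.

(** The image of [h] is closed under successors, so nothing outside it is visible. This transfers
    types to the parts of a [sprout] and to coded models. *)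
Lemma ftype_embedding (W W' : finType) (M : model P a W) (M' : model P a W')
    (h : W -> W') : injective h ->
  (forall w, props_at M' (h w) = props_at M w) ->
  (forall al w, nbhd M' al (h w) = h @: nbhd M al w) ->
  forall n w, ftype M' n (h w) = ftype M n w.
Proof.
move=> inj Hp Hn; elim=> [|n IH] w; first by rewrite /= /type_eps Hp.
rewrite [LHS]/= [RHS]/= /type_eps Hp; apply: perm_node_type => al.
rewrite Hn; apply: perm_trans (perm_map _ (enum_imset_inj _ inj)) _.
by rewrite -map_comp (@eq_map _ _ (ftype M' n \o h) (ftype M n) IH).
Qed.

Record pointed := Pointed {
  carrier : finType;
  pmodel : model P a carrier;
  point : carrier
}.

Section Sprout.
Variables (S : {set P}) (m : 'I_a -> nat) (part : forall al, 'I_(m al) -> pointed).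

Definition sprout_index := {al : 'I_a & 'I_(m al)}.

Definition sprout_part (i : sprout_index) : pointed := part (tagged i).

Definition sprout_sum := {i : sprout_index & carrier (sprout_part i)}.

(** A fresh root [None] over a disjoint union. Parts are indexed by position, so equal parts are
    still distinct successors and multiplicities are kept. *)
Definition sprout : model P a (option sprout_sum) := Model
  (fun al x y =>
    match x, y with
    | None, Some v =>
        (tag (tag v) == al) && (tagged v == point (sprout_part (tag v)))
    | Some u, Some v =>
        (tag u == tag v) && mrel (pmodel (sprout_part (tag u))) al
          (tagged u) (tagged_as u v)
    | _, None => false
    end)
  (fun p => [set x | match x with
    | None => p \in S
    | Some u => tagged u \in mval (pmodel (sprout_part (tag u))) p
    end]).

Definition sprout_in (i : sprout_index) (u : carrier (sprout_part i)) :
  option sprout_sum := Some (Tagged (fun i => carrier (sprout_part i)) u).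

Lemma sprout_in_inj i : injective (@sprout_in i).
Proof. by move=> u v /Some_inj/eqP; rewrite eq_Tagged => /eqP. Qed.

Lemma ftype_sprout_in n i (u : carrier (sprout_part i)) :
  ftype sprout n (sprout_in u) = ftype (pmodel (sprout_part i)) n u.
Proof.
apply: ftype_embedding (@sprout_in_inj i) _ _ n u => [w|al w].
  by apply/setP => p; rewrite !inE.
apply/setP => -[y|]; rewrite inE; last by symmetry; apply/imsetP => -[].
apply/andP/imsetP => [[/= /eqP]|[v wv /Some_inj->]].
  case: y => j v /= ij; move: v; rewrite -ij => v; rewrite tagged_asE => wv.
  by exists v => //; rewrite inE.
by rewrite /= eqxx tagged_asE; rewrite inE in wv.
Qed.

Lemma ftype_sprout_root n :
  ftype sprout n.+1 None =
  node_type (type_eps_set a S) (fun al =>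
    [seq ftype (pmodel (part j)) n (point (part j)) | j <- enum 'I_(m al)]).
Proof.
rewrite [LHS]/=; have -> : type_eps sprout None = type_eps_set a S.
  by congr type_eps_set; apply/setP => p; rewrite !inE.
apply: perm_node_type => al.
pose idx (j : 'I_(m al)) : sprout_index := Tagged (fun al => 'I_(m al)) j.
pose root (j : 'I_(m al)) := sprout_in (point (sprout_part (idx j))).
have -> : nbhd sprout al None = root @: [set: 'I_(m al)].
  apply/setP => -[y|]; rewrite inE; last by symmetry; apply/imsetP => -[].
  apply/andP/imsetP => [[/= /eqP]|[j _ /Some_inj->]]; last by rewrite /= !eqxx.
  case: y => -[al' j] v /= E; move: j v; rewrite E => j v /eqP->.
  by exists j; rewrite ?inE.
have inj : injective root.
  move=> j1 j2 /Some_inj/(congr1 tag)/eqP; rewrite eq_Tagged => /eqP.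
  exact.
apply: perm_trans (perm_map _ (enum_imset_inj _ inj)) _.
rewrite -map_comp enum_setT -enumT.
rewrite (@eq_map _ _ _ (fun j => ftype (pmodel (part j)) n (point (part j)))) //.
by move=> j; apply: ftype_sprout_in.
Qed.

End Sprout.

(** Choosing a pointed model for each list entry and sprouting a root over them realizes the
    formula; transition values therefore stay among the full types. *)
Lemma is_full_node_type n (S : {set P}) (ls : 'I_a -> seq formula) :
  (forall al f, f \in ls al -> is_full_type n f) ->
  is_full_type n.+1 (node_type (type_eps_set a S) ls).
Proof.
move=> H.
have H' al (j : 'I_(size (ls al))) : exists p : pointed,
    ftype (pmodel p) n (point p) = tnth (in_tuple (ls al)) j.
  have /is_full_typeP[W [M [w E]]] := H al _ (mem_tnth j (in_tuple (ls al))).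
  by exists (Pointed M w).
pose part al j := proj1_sig (constructive_indefinite_description _ (H' al j)).
apply/is_full_typeP; exists _, (sprout S part), None.
rewrite ftype_sprout_root; apply: perm_node_type => al.
rewrite (@eq_map _ _ _ (tnth (in_tuple (ls al)))).
  by rewrite map_tnth_enum.
by move=> j; apply: (proj2_sig (constructive_indefinite_description _ (H' al j))).
Qed.

End Automaton.

(** * The type automaton *)

Ltac cpf := cp; repeat (match goal with
  | |- comput (fun x => FVar (@?p x)) => apply: comput_FVar
  | |- comput (fun x => FNeg (@?f x)) => apply: comput_FNeg
  | |- comput (fun x => FAnd (@?f x) (@?g x)) => apply: comput_FAnd
  | |- comput (fun x => FDia (@?al x) (@?k x) (@?f x)) => apply: comput_FDia
  | |- comput (fun x => FDiaEq (@?al x) (@?k x) (@?f x)) => apply: comput_FDiaEq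
  end; cp).

Section TypeDelta.
Variables (P : finType) (a : nat).
Hypothesis a_gt0 : 0 < a.
Local Notation formula := (formula P a).
Local Notation fullT := (fullT P a).
Definition fval (t : fullT) : formula := proj1_sig t.

Lemma fval_inj : injective fval.
Proof. exact: pcan_inj (@fullT_valK P a). Qed.

Lemma is_full_ftype (W : finType) (M : model P a W) n w : is_full (ftype M n w).
Proof. by exists n; apply/is_full_typeP; exists W, M, w. Qed.

Lemma type_delta_value_node (ls : 'I_a -> seq fullT) tau :
  type_delta_value ls tau =
  node_type (type0_of (fval tau)) (fun al => map fval (ls al)).
Proof.
rewrite /type_delta_value /node_type /node_conjuncts.
congr (conjL (_ :: canon (_ ++ _))); last first.
  by apply/eq_map => al; rewrite size_map.
congr flatten; apply/eq_map => al /=; rewrite (undup_map_inj fval_inj).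
rewrite -map_comp; apply/eq_map => s /=; rewrite count_map.
by congr FDiaEq; apply: eq_count => s' /=; rewrite (inj_eq fval_inj).
Qed.

Lemma type0_of_full (tau : fullT) : exists S, type0_of (fval tau) = type_eps_set a S.
Proof.
have [n /is_full_typeP[W [M [w E]]]] := proj2_sig tau.
by exists (props_at M w); rewrite /fval -E type0_of_ftype.
Qed.

Definition delta_spec (N : 'I_a -> mset fullT) (tau v : fullT) : Prop :=
  exists (ls : 'I_a -> seq fullT) (n : nat),
    [/\ forall al, N al =1 mset_of (ls al),
        forall al s, 0 < N al s -> is_full_type n (fval s)
      & fval v = type_delta_value ls tau].

(** The value is chosen on multisets, where no listing is at hand; all listings give the same
    formula by [perm_node_type]. Without a common depth the default is [tau], which a machine can
    simply copy. *)
Definition type_delta (N : 'I_a -> mset fullT) (tau : fullT) : fullT :=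
  match excluded_middle_informative (exists v, delta_spec N tau v) with
  | left ex => proj1_sig (constructive_indefinite_description _ ex)
  | right _ => tau
  end.

Lemma mset_of_perm (T : eqType) (s t : seq T) : mset_of s =1 mset_of t -> perm_eq s t.
Proof. by move=> E; apply/allP => x _; apply/eqP; apply: E. Qed.

Lemma mset_of_gt0 (T : eqType) (s : seq T) x : (0 < mset_of s x) = (x \in s).
Proof. by rewrite -has_count has_pred1. Qed.

Lemma type_delta_eq N tau (ls : 'I_a -> seq fullT) n :
  (forall al, N al =1 mset_of (ls al)) ->
  (forall al s, 0 < N al s -> is_full_type n (fval s)) ->
  fval (type_delta N tau) = type_delta_value ls tau.
Proof.
move=> EN HN; rewrite /type_delta; case: excluded_middle_informative => [ex|[]].
  case: constructive_indefinite_description => v [ls' [_ [EN' _ /= ->]]].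
  rewrite !type_delta_value_node; apply: perm_node_type => al.
  by apply/perm_map/mset_of_perm => s; rewrite -EN -EN'.
have [S ES] := type0_of_full tau.
have full : is_full (type_delta_value ls tau).
  exists n.+1; rewrite type_delta_value_node ES; apply: is_full_node_type => al f.
  by case/mapP => s si ->; apply: (HN al); rewrite EN mset_of_gt0.
by exists (exist _ _ full), ls, n.
Qed.

Lemma type_delta_id (ls : 'I_a -> seq fullT) tau :
  ~ (exists n, forall al s, s \in ls al -> is_full_type n (fval s)) ->
  type_delta (fun al => mset_of (ls al)) tau = tau.
Proof.
move=> nex; rewrite /type_delta; case: excluded_middle_informative => // ex.
exfalso; case: ex => v [ls' [n [_ HN _]]]; case: nex; exists n => al s si; apply: (HN al).
by rewrite mset_of_gt0.
Qed.

Lemma is_full_type_eps_set (S : {set P}) : is_full (type_eps_set a S).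
Proof.
exists 0; apply/is_full_typeP.
exists _, (Model (fun (_ : 'I_a) (_ _ : unit) => false)
                 (fun p => [set x | p \in S])), tt.
by congr type_eps_set; apply/setP => p; rewrite !inE.
Qed.

Definition type_init (S : {set P}) : fullT := exist _ _ (is_full_type_eps_set S).

Lemma type_delta_automaton : type_automaton type_init type_delta.
Proof.
by split=> // N tau n HN _ ls EN; apply: type_delta_eq EN HN.
Qed.

Lemma run_ftype pi delta : type_automaton pi delta ->
  forall (W : finType) (M : model P a W) t w,
  fval (run pi delta M t w) = ftype M t w.
Proof.
move=> [Hpi Hdelta] W M; elim=> [|t IH] w; first exact: Hpi.
pose ls al := [seq run pi delta M t v | v <- enum (nbhd M al w)].
transitivity (type_delta_value ls (run pi delta M t w)).
  apply: (Hdelta _ _ t) => [al s||al s].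
  - rewrite card_gt0 => /set0Pn[v]; rewrite inE => /andP[_ /eqP<-].
    by apply/is_full_typeP; exists W, M, v; rewrite -IH.
  - by apply/is_full_typeP; exists W, M, w; rewrite -IH.
  - rewrite /mset_of count_map count_enum.
    by apply: eq_card => v; rewrite !inE.
rewrite type_delta_value_node IH type0_of_ftype //.
rewrite [RHS]/=; apply: perm_node_type => al; rewrite -map_comp.
by rewrite (@eq_map _ _ _ (ftype M t)).
Qed.

(** The depth [n] is not tied to the round in which the state occurs. *)
Definition accepting (S : formula -> Prop) (tau : fullT) : Prop :=
  exists (n : nat) (f : formula) (W : finType) (M : model P a W) (w : W),
    [/\ S f, depth f <= n, sat M w f & ftype M n w = fval tau].

Lemma accepting_recognizes pi delta S K : type_automaton pi delta ->
  defines S K -> recognizes pi delta (accepting S) K.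
Proof.
move=> Haut HK W M w; apply: iff_trans (HK W M w) _; split.
  move=> [f [Sf sf]]; exists (depth f); exists (depth f), f, W, M, w.
  by rewrite run_ftype.
move=> [t [n [f [W' [M' [w' [Sf lef sf]]]]]]]; rewrite run_ftype // => E.
exists f; split=> //; rewrite (sat_ftype_eq (M := M') (w := w') lef) //.
(* The state has depth [t], possibly different from [n]. As a formula it holds at [w], and being a
   type of depth [n] of another model it is then also the type of depth [n] of [w]. *)
by apply/ftype_sat; rewrite E; apply/ftype_sat.
Qed.

(** * Computability of the transition function *)

Implicit Types A : countType.

Lemma comput_conjL A (s : A -> seq formula) :
  comput s -> comput (fun x => conjL (s x)).
Proof.
move=> cs; apply: (@comput_ext _ _ (fun x =>
  (foldr (fun f (acc : bool * formula) =>
     (true, if acc.1 then FAnd f acc.2 else f)) (false, FTop) (s x)).2)).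
  move=> x; elim: (s x) => // f l; case: l => // g l IH.
  by rewrite -[conjL _]/(FAnd f (conjL (g :: l))) -IH.
apply: comput_snd; apply: comput_foldr; cp.
by apply: comput_if; cp; apply: comput_FAnd; cp.
Qed.

Lemma comput_canon A (s : A -> seq formula) :
  comput s -> comput (fun x => canon (s x)).
Proof.
move=> cs; apply: comput_sort.
- exact: le_formula_total.
- exact: le_formula_trans.
- exact: le_formula_anti.
- by rewrite /le_formula; cp.
- exact: comput_undup.
Qed.

Lemma comput_node_type A (t0 : A -> formula) (ls : A -> 'I_a -> seq formula) :
  comput t0 -> comput (fun z : A * 'I_a => ls z.1 z.2) ->
  comput (fun x => node_type (t0 x) (ls x)).
Proof.
move=> ct cls; apply: comput_conjL; cp; apply: comput_canon; apply: comput_cat.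
  apply: comput_flatten; apply: comput_map; cp; apply: comput_map.
    exact: comput_undup.
  have cl : comput (fun z : A * 'I_a * formula => ls z.1.1 z.1.2).
    by apply: (comput_app2 cls); cp.
  by apply: comput_FDiaEq; cp; apply: comput_count; rewrite /=; cp.
apply: comput_map; cp; apply: comput_FDiaEq; cp.
by apply: comput_size; apply: (comput_app2 cls); cp.
Qed.

Lemma comput_type0_of A (f : A -> formula) :
  comput f -> comput (fun x => type0_of (f x)).
Proof.
move=> cf.
(* [type0_of] returns a subformula, so the fold carries the formula itself, its modal freeness and
   the result. *)
pose conj (u v : formula * (bool * formula)) : formula * (bool * formula) :=
  (FAnd u.1 v.1, (u.2.1 && v.2.1, if u.2.1 && v.2.1 then FAnd u.1 v.1 else u.1)).
pose fold := formula_fold (FTop, (true, FTop)) (fun p => (FVar p, (true, FVar p)))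
  (fun u => (FNeg u.1, (u.2.1, FNeg u.1))) conj
  (fun al k u => (FDia al k u.1, (false, FDia al k u.1))).
have foldE g : fold g = (g, (modal_free g, type0_of g)).
  elim: g => [|p|g IH|g IHg h IHh|al k g IH]; rewrite /fold //= -/fold.
  - by rewrite IH /type0_of /=; case: (modal_free g).
  - by rewrite IHg IHh /conj /type0_of /=.
  - by rewrite IH.
apply: (@comput_ext _ _ (fun x => (fold (f x)).2.2)); first by move=> x; rewrite foldE.
apply: comput_snd; apply: comput_snd; apply: comput_formula_fold; cp.
all: rewrite ?/conj; cpf.
by apply: comput_if; cpf.
Qed.

Lemma comput_height A (f : A -> formula) : comput f -> comput (fun x => height (f x)).
Proof.
move=> cf; apply: (@comput_ext _ _ (fun x => formula_fold 0 (fun=> 0) (fun=> 0)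
  maxn (fun _ k u => if k is 0 then 0 else u.+1) (f x))).
  by move=> x; elim: (f x) => //= [g -> h ->|al [|k] g IH] //; rewrite IH.
by apply: comput_formula_fold; cp; apply: comput_nat_case; cp.
Qed.

Lemma comput_mdepth A (f : A -> formula) : comput f -> comput (fun x => mdepth (f x)).
Proof.
move=> cf; apply: (@comput_ext _ _ (fun x => formula_fold 0 (fun=> 0) (fun=> 0)
  maxn (fun _ _ u => u.+1) (f x))).
  by move=> x; elim: (f x) => //= [g -> h ->|al k g ->].
by apply: comput_formula_fold; cp.
Qed.

Lemma comput_depth A (f : A -> formula) : comput f -> comput (fun x => depth (f x)).
Proof.
move=> cf; apply: (@comput_ext _ _ (fun x => formula_fold 0 (fun=> 0) id
  maxn (fun _ _ u => u.+1) (f x))).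
  by move=> x; elim: (f x) => //= [g -> h ->|al k g ->].
by apply: comput_formula_fold; cp.
Qed.

Lemma comput_consistent A (s : A -> seq formula) :
  comput s -> comput (fun x => consistent (s x)).
Proof.
move=> cs; apply: comput_all => //; cp.
- by apply: comput_mdepth; cp.
- apply: comput_foldr; cp.
  by apply: comput_map; [apply: (comput_comp cs); cp|apply: comput_mdepth; cp].
- by apply: comput_height; cp.
- by apply: comput_mdepth; cp.
Qed.

(** [consistent] decides between the prescribed value and the default, so the classically chosen
    [type_delta] agrees with an explicit function on formulae. *)
Lemma type_delta_computable : delta_computable type_delta.
Proof.
pose G (z : seq (seq formula) * formula) : formula :=
  if consistent (flatten z.1)
  then node_type (type0_of z.2) (fun al : 'I_a => nth [::] z.1 al) else z.2.
have [r cr Hr] : comput G.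
  apply: comput_if; cp.
    by apply: comput_consistent; apply: comput_flatten; cp.
  apply: comput_node_type; first by apply: comput_type0_of; cp.
  apply: comput_nth; cp; apply: (@comput_code _ _ _ (fun z => z.2)) => //.
  by cp.
have [p Hp] := cfun_machine cr; exists p => ls q; cbv zeta.
set lss := [seq map fval (ls al) | al <- enum 'I_a].
(* A full type is pickled as its formula and a list through the codes of its entries, so the input
   already codes nested lists of formulae. *)
have -> : pickle ([seq [seq pickle x | x <- ls al] | al <- enum 'I_a], pickle q) =
    pickle (lss, fval q).
  rewrite !pickle_pair; congr pcons.
  rewrite pickle_seqE [RHS]pickle_seqE /lss -!map_comp.
  congr CodeSeq.code; apply/eq_map => al.
  by rewrite /comp pickle_seqE [RHS]pickle_seqE -!map_comp.
have [t [Ht Et]] := Hp (pickle (lss, fval q)); exists t; split=> //.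
rewrite Et Hr -[RHS]/(pickle (fval _)); congr pickle; rewrite /G /=.
have nth_lss (al : 'I_a) : nth [::] lss al = map fval (ls al).
  by rewrite (nth_map al) ?nth_ord_enum // size_enum_ord.
have mem_lss f : f \in flatten lss -> exists al s, s \in ls al /\ f = fval s.
  by case/flatten_mapP => al _ /mapP[s si ->]; exists al, s.
have full f : f \in flatten lss -> is_full f.
  by case/mem_lss => al [s [_ ->]]; apply: (proj2_sig s).
case: ifP => [/(consistentP a_gt0 full)[n Hn]|ncons].
  rewrite (@type_delta_eq _ q ls n) // => [|al s].
    rewrite type_delta_value_node; apply: perm_node_type => al.
    by rewrite nth_lss.
  rewrite mset_of_gt0 => si; apply: Hn; apply/flatten_mapP.
  by exists al; rewrite ?mem_enum ?map_f.
rewrite type_delta_id // => -[n Hn]; move/negP: ncons; apply.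
apply/(consistentP a_gt0 full); exists n => f /mem_lss[al [s [si ->]]].
exact: Hn si.
Qed.

End TypeDelta.

(** * Semi-deciding acceptance *)

Section Search.
Variables (P : finType) (a : nat).
Hypothesis a_gt0 : 0 < a.
Local Notation formula := (formula P a).
Local Notation fullT := (fullT P a).

(* A finite list of numbers codes the model on ['I_m] whose edges and atoms *)
(* are the triples and pairs with a code in the list.                        *)
Definition edge_code (al : 'I_a) (u v : nat) : nat := pickle [:: val al; u; v].
Definition atom_code (p : P) (u : nat) : nat := pickle [:: pickle p; u].

Definition coded_model (m : nat) (L : seq nat) : model P a 'I_m := Model
  (fun al (u v : 'I_m) => edge_code al u v \in L)
  (fun p => [set u : 'I_m | atom_code p u \in L]).

(** Points are renamed by their ranks, and the finitely many edges and atoms are listed. *)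
Lemma coded_model_exists (W : finType) (M : model P a W) (w : W) :
  exists m L (u : 'I_m), forall n, ftype (coded_model m L) n u = ftype M n w.
Proof.
pose rk (w : W) : nat := enum_rank w.
pose L := [seq edge_code t.1 (rk t.2.1) (rk t.2.2) |
             t <- enum {: 'I_a * (W * W)} & mrel M t.1 t.2.1 t.2.2] ++
  [seq atom_code t.1 (rk t.2) | t <- enum {: P * W} & t.2 \in mval M t.1].
have edgeE al u v : (edge_code al (rk u) (rk v) \in L) = mrel M al u v.
  rewrite mem_cat; apply/orP/idP => [[]|uv].
  - case/mapP => -[al' [u' v']]; rewrite mem_filter /= => /andP[uv _].
    move/(pcan_inj pickleK) => [/val_inj-> Eu Ev].
    by rewrite (enum_rank_inj (val_inj Eu)) (enum_rank_inj (val_inj Ev)).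
  (* Edge codes come from lists of length 3 and atom codes from lists of length 2, so they never
     clash. *)
  - by case/mapP => -[p x] _ /(pcan_inj pickleK).
  - left; apply/mapP; exists (al, (u, v)) => //.
    by rewrite mem_filter /= uv mem_enum.
have atomE p u : (atom_code p (rk u) \in L) = (u \in mval M p).
  rewrite mem_cat; apply/orP/idP => [[]|up].
  - by case/mapP => -[al' [u' v']] _ /(pcan_inj pickleK).
  - case/mapP => -[p' u']; rewrite mem_filter /= => /andP[up _].
    move/(pcan_inj pickleK) => [/(pcan_inj pickleK)-> Eu].
    by rewrite (enum_rank_inj (val_inj Eu)).
  - right; apply/mapP; exists (p, u) => //.
    by rewrite mem_filter /= up mem_enum.
exists #|W|, L, (enum_rank w) => n.
apply: (ftype_embedding (h := enum_rank)) => [|u|al u]; first exact: enum_rank_inj.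
  by apply/setP => p; rewrite !inE -atomE.
apply/setP => v; rewrite inE /= -[v]enum_valK edgeE mem_imset ?inE //.
exact: enum_rank_inj.
Qed.

(** The extension of a formula as a list of points, so that model checking becomes a fold over the
    formula. *)
Definition truth (m : nat) (L : seq nat) : formula -> seq nat :=
  formula_fold (iota 0 m)
    (fun p => [seq u <- iota 0 m | atom_code p u \in L])
    (fun s => [seq u <- iota 0 m | u \notin s])
    (fun s t => [seq u <- iota 0 m | (u \in s) && (u \in t)])
    (fun al k s => [seq u <- iota 0 m |
       k <= count (fun v => (edge_code al u v \in L) && (v \in s)) (iota 0 m)]).

Lemma mem_truth m L f (u : 'I_m) :
  (val u \in truth m L f) = sat (coded_model m L) u f.
Proof.
have um : val u \in iota 0 m by rewrite mem_iota add0n leq0n /=.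
rewrite /truth; elim: f u um => [|p|g IH|g IHg h IHh|al k g IH] u um /=.
- exact: um.
- by rewrite mem_filter um andbT inE.
- by rewrite mem_filter um andbT IH.
- by rewrite mem_filter um andbT IHg ?IHh.
rewrite mem_filter um andbT; congr (_ <= _).
rewrite -[X in count _ X]val_enum_ord count_map enumT -enum_setT count_enum.
apply: eq_card => v; rewrite !inE /=; congr andb.
by apply: IH; rewrite mem_iota add0n leq0n /=.
Qed.

Definition coded_eps (L : seq nat) (u : nat) : formula :=
  conjL [seq if atom_code p u \in L then FVar p else FNeg (FVar p) | p <- enum P].

(** A table of the types of all points, renewed level by level; the recursion over successors thus
    becomes an iteration. *)
Definition coded_types (m : nat) (L : seq nat) (n : nat) : seq formula :=
  iter n (fun ts => [seq node_type (coded_eps L u) (fun al =>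
      [seq nth FTop ts v | v <- iota 0 m & edge_code al u v \in L]) | u <- iota 0 m])
    [seq coded_eps L u | u <- iota 0 m].

Lemma coded_epsE m L (u : 'I_m) : coded_eps L u = type_eps (coded_model m L) u.
Proof. by congr conjL; apply/eq_map => p; rewrite !inE. Qed.

Lemma nth_coded_types m L n (u : 'I_m) :
  nth FTop (coded_types m L n) u = ftype (coded_model m L) n u.
Proof.
elim: n u => [|n IH] u; rewrite [coded_types _ _ _]/= (nth_map 0) ?size_iota //;
  rewrite nth_iota // add0n coded_epsE // [RHS]/=.
apply: perm_node_type => al; rewrite -val_enum_ord filter_map -map_comp.
rewrite (@eq_map _ _ _ (ftype (coded_model m L) n)) => [|v]; last exact: IH.
apply: perm_map; apply: uniq_perm => [||v].
- by rewrite filter_uniq ?enum_uniq.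
- exact: enum_uniq.
- by rewrite mem_filter !mem_enum !inE andbT.
Qed.

Implicit Types A : countType.

Lemma comput_edge_code A (al : A -> 'I_a) (u v : A -> nat) :
  comput al -> comput u -> comput v -> comput (fun x => edge_code (al x) (u x) (v x)).
Proof.
by move=> cal cu cv; apply: comput_pickle; cp; apply: comput_code cal.
Qed.

Lemma comput_atom_code A (p : A -> P) (u : A -> nat) :
  comput p -> comput u -> comput (fun x => atom_code (p x) (u x)).
Proof. by move=> cP cu; apply: comput_pickle; cp. Qed.

Lemma comput_truth A (m : A -> nat) (L : A -> seq nat) (f : A -> formula) :
  comput m -> comput L -> comput f -> comput (fun x => truth (m x) (L x) (f x)).
Proof.
move=> cm cL cf; have ci := comput_iota cm.
have cin (B : countType) (g : B -> A) : comput g -> comput (fun y => iota 0 (m (g y))).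
  by move=> cg; exact: (comput_comp ci cg).
apply: comput_formula_fold => //.
- apply: comput_filter; first by apply: cin; cp.
  by apply: comput_mem; [apply: comput_atom_code; cp|apply: (comput_comp cL); cp].
- apply: comput_filter; first by apply: cin; cp.
  by cp; apply: comput_mem; cp.
- apply: comput_filter; first by apply: cin; cp.
  by cp; apply: comput_mem; cp.
- apply: comput_filter; first by apply: cin; cp.
  cp; apply: comput_count; first by apply: cin; cp.
  cp; apply: comput_mem; cp; last by apply: (comput_comp cL); cp.
  by apply: comput_edge_code; cp.
Qed.

Lemma comput_coded_eps A (L : A -> seq nat) (u : A -> nat) :
  comput L -> comput u -> comput (fun x => coded_eps (L x) (u x)).
Proof.
move=> cL cu; apply: comput_conjL; apply: comput_map; cp.
apply: comput_if; cpf; apply: comput_mem; last by apply: (comput_comp cL); cp.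
by apply: comput_atom_code; cp; apply: (comput_comp cu); cp.
Qed.

Lemma comput_coded_types A (m : A -> nat) (L : A -> seq nat) (n : A -> nat) :
  comput m -> comput L -> comput n ->
  comput (fun x => coded_types (m x) (L x) (n x)).
Proof.
move=> cm cL cn; have ci := comput_iota cm.
have cin (B : countType) (g : B -> A) : comput g -> comput (fun y => iota 0 (m (g y))).
  by move=> cg; exact: (comput_comp ci cg).
have cLn (B : countType) (g : B -> A) : comput g -> comput (fun y => L (g y)).
  by move=> cg; exact: (comput_comp cL cg).
apply: comput_iter => //; last first.
  by apply: comput_map => //; apply: comput_coded_eps; cp; apply: cLn; cp.
apply: comput_map; first by apply: cin; cp.
apply: comput_node_type; first by apply: comput_coded_eps; cp; apply: cLn; cp.
apply: comput_map; last by apply: comput_nth; cp.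
apply: comput_filter; first by apply: cin; cp.
apply: comput_mem; last by apply: cLn; cp.
by apply: comput_edge_code; cp.
Qed.

(* [z] lists a formula, the size, the point and the code of a model, a depth *)
(* and the code of a type.                                                    *)
Definition witness (z : formula * (nat * nat * seq nat * nat * nat)) : bool :=
  let: (f, (m, u, L, n, c)) := z in
  [&& u < m, depth f <= n, u \in truth m L f
    & pickle (nth FTop (coded_types m L n) u) == c].

Lemma comput_witness : comput witness.
Proof.
apply: (@comput_ext _ _ (fun z : formula * (nat * nat * seq nat * nat * nat) =>
  [&& z.2.1.1.1.2 < z.2.1.1.1.1, depth z.1 <= z.2.1.2,
      z.2.1.1.1.2 \in truth z.2.1.1.1.1 z.2.1.1.2 z.1
    & pickle (nth FTop (coded_types z.2.1.1.1.1 z.2.1.1.2 z.2.1.2) z.2.1.1.1.2)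
      == z.2.2])).
  by case=> f [[[[m u] L] n] c].
cp.
- by apply: comput_depth; cp.
- by apply: comput_mem; cp; apply: comput_truth; cp.
- by apply: comput_nth; cp; apply: comput_coded_types; cp.
Qed.

(** Every accepting type is realized in a coded model, so acceptance is the existence of a number
    with a decidable property and [cfun_search] applies. *)
Lemma accepting_re (S : formula -> Prop) : re_set S -> re_set (accepting S).
Proof.
case=> p Hp.
have [rw cw Hw] := comput_witness.
pose data (x : nat) : nat * nat * seq nat * nat * nat :=
  let t := ctl (ctl (ctl x)) in
  (chd t, chd (ctl t), CodeSeq.decode (ctl (ctl (ctl t))), chd (ctl (ctl t)), chd x).
have [rd cd Hd] : comput data.
  rewrite /data; cp; try apply: comput_decode; repeat (cp; first
    [apply: comput_chd | apply: comput_ctl]).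
have [rh ch Hh] : comput (fun x => cm_halts p (chd (ctl x)) (chd (ctl (ctl x)))).
  by apply: comput_halts; repeat (cp; first [apply: comput_chd | apply: comput_ctl]).
(* [rw] is meaningful only on codes of formulae. The halting test for [S] comes before its use:
   success guarantees that the candidate number codes a formula of [S]. *)
pose b x := if rh x == 0 then 0 else rw (pcons (chd (ctl x)) (pcons (rd x) 0)).
have cb : cfun b.
  apply: cfun_if => //; first exact: cfun_const.
  apply: cfun_pcons_comp => //; first exact: cfun_comp cfun_chd cfun_ctl.
  by apply: cfun_pcons => //; apply: cfun_const.
have bE x : b x = if cm_halts p (chd (ctl x)) (chd (ctl (ctl x)))
    then rw (pcons (chd (ctl x)) (pcons (pickle (data x)) 0)) else 0.
  by rewrite /b (Hh x : rh x = _) (Hd x : rd x = _); case: cm_halts.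
have [q Hq] := cfun_search cb; exists q => c; apply: iff_trans (Hq c); split.
  case=> tau [[n [f [W [M [w [Sf lef sf Etau]]]]]] <-].
  have [m [L [u Eu]]] := coded_model_exists M w.
  have /(Hp (pickle f))[s halts] : exists g, S g /\ pickle g = pickle f by exists f.
  exists (pcons (pickle f) (pcons s (pcons m (pcons (val u)
    (pcons n (CodeSeq.code L)))))).
  rewrite bE !(ctl_pcons, chd_pcons) halts /data !(ctl_pcons, chd_pcons).
  rewrite CodeSeq.codeK -pickle_pair Hw /witness ltn_ord lef mem_truth.
  rewrite (sat_ftype_eq (M := M) (w := w) lef) // sf nth_coded_types Eu Etau.
  by rewrite -[pickle tau]/(pickle (fval tau)) eqxx.
case=> t; rewrite bE !(ctl_pcons, chd_pcons).
case: ifP => // halts.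
have /Hp[f [Sf Ef]] : exists s, cm_halts p (chd t) s by exists (chd (ctl t)).
rewrite -Ef -pickle_pair Hw /data !(ctl_pcons, chd_pcons).
set m := chd (ctl (ctl t)); set u := chd (ctl (ctl (ctl t))).
set L := CodeSeq.decode _; set n := chd _.
rewrite /witness; case: and4P => // -[ltu lef uf /eqP <-] _.
(* The number searched for is the code of a type computed in the coded model, hence of a full
   type. *)
exists (exist _ _ (is_full_ftype (coded_model m L) n (Ordinal ltu))); split.
  exists n, f, _, (coded_model m L), (Ordinal ltu); split=> //.
  by rewrite -mem_truth.
by rewrite -[u]/(val (Ordinal ltu)) nth_coded_types.
Qed.

End Search.

Theorem theorem1 (P : finType) (a : nat) (Ha : 0 < a) :
  (forall (K : mclass P a) (S : formula P a -> Prop),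
     defines S K ->
     exists (pi : {set P} -> fullT P a)
            (delta : ('I_a -> mset (fullT P a)) -> fullT P a -> fullT P a)
            (F : fullT P a -> Prop),
       type_automaton pi delta /\ recognizes pi delta F K) /\
  (forall (K : mclass P a) (S : formula P a -> Prop),
     defines S K -> re_set S ->
     exists (pi : {set P} -> fullT P a)
            (delta : ('I_a -> mset (fullT P a)) -> fullT P a -> fullT P a)
            (F : fullT P a -> Prop),
       type_automaton pi delta /\ re_automaton delta F /\
       recognizes pi delta F K).
Proof.
split=> K S HK => [|reS]; exists (@type_init P a), (@type_delta P a), (accepting S).
  by split; [|apply: accepting_recognizes]; rewrite //; apply: type_delta_automaton.
split; first exact: type_delta_automaton.
split; first by split; [apply: accepting_re|apply: type_delta_computable].
by apply: accepting_recognizes => //; apply: type_delta_automaton.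
Qed.
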